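(* Let $n\geq 3$ be an integer and let $1\leq k\leq\infty$. Let $f:\mathbb{R}^n\setminus\{0\}\to\mathbb{R}^n$ be a positively homogeneous mapping of order $\varkappa>0$, i.e. $f(\tau\xi)=\tau^{\varkappa}f(\xi)$ for all $\tau>0$ and all $\xi\neq 0$. Assume that $f\in C^k(\mathbb{R}^n\setminus\{0\})$ and that its Jacobian $\det Df$ never vanishes on $\mathbb{R}^n\setminus\{0\}$. Then $f$ is bijective from $\mathbb{R}^n\setminus\{0\}$ to $\mathbb{R}^n\setminus\{0\}$, its global inverse satisfies $f^{-1}\in C^k(\mathbb{R}^n\setminus\{0\})$, and $f^{-1}$ is positively homogeneous of order $1/\varkappa$, i.e. $f^{-1}(\tau\eta)=\tau^{1/\varkappa}f^{-1}(\eta)$ for all $\tau>0$ and all $\eta\neq 0$. Moreover, if $f$ is extended to $\mathbb{R}^n$ by setting $f(0)=0$, the extension is a global homeomorphism of $\mathbb{R}^n$ onto $\mathbb{R}^n$.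
   Context: The Jacobian of a differentiable map $f=(f_1,\dots,f_n)$ is $\det Df=\det(\partial f_i/\partial x_j)$. The order $\varkappa$ is a real number. The parameter $k$ is a positive integer or $\infty$. *)

(* Defs.v *)
From mathcomp Require Export all_boot all_order all_algebra.
From mathcomp Require Export all_classical all_reals all_analysis.

Set Implicit Arguments.
Unset Strict Implicit.
Unset Printing Implicit Defensive.

Import Order.TTheory GRing.Theory Num.Theory.
Import numFieldNormedType.Exports.
Export numFieldNormedType.Exports.

Local Open Scope classical_set_scope.
Local Open Scope ring_scope.

(* C^m on an open set U: every iterated partial derivative of order at most m
   exists and is continuous on U.  Functions are total, but since U is
   open the derivatives at points of U depend only on the values of f on U. *)
Fixpoint Cn_on (R : realType) (n : nat) (W : normedModType R)
    (U : set 'rV[R]_n) (m : nat) (f : 'rV[R]_n -> W) : Prop :=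
  (forall x, U x -> {for x, continuous f}) /\
  match m with
  | 0%N => True
  | m'.+1 => forall j : 'I_n,
      (forall x, U x -> derivable f x (delta_mx 0 j)) /\
      Cn_on U m' (fun x => 'D_(delta_mx 0 j) f x)
  end.

(* The order k is [Some m] for finite m and [None] for infinity. *)
Definition Ck_on (R : realType) (n : nat) (W : normedModType R)
    (U : set 'rV[R]_n) (k : option nat) (f : 'rV[R]_n -> W) : Prop :=
  match k with
  | Some m => Cn_on U m f
  | None => forall m : nat, Cn_on U m f
  end.

Definition pos_homogeneous (R : realType) (n : nat) (a : R)
    (f : 'rV[R]_n -> 'rV[R]_n) : Prop :=
  forall (t : R) (x : 'rV[R]_n), 0 < t -> x != 0 -> f (t *: x) = t `^ a *: f x.

Definition extend0 (R : realType) (n : nat) (f : 'rV[R]_n -> 'rV[R]_n)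
    (x : 'rV[R]_n) : 'rV[R]_n :=
  if x == 0 then 0 else f x.

Definition homeomorphism (X Y : topologicalType) (f : X -> Y) : Prop :=
  continuous f /\
  exists g : Y -> X, [/\ cancel f g, cancel g f & continuous g].

(* Main.v *)
(* By the inverse function theorem f is locally injective and open; by
   homogeneity it has no zero, as it would vanish along a whole ray, and it is
   proper as a map of R^n \ 0 to itself.  For injectivity let f x = f x' = y.
   By homogeneity the preimage of the ray through -y is a
   finite union of rays, so for n >= 3 there is m such that the polygonal path
   x -> m -> x' misses it; the image of the path is then a loop at y that avoids
   the ray through -y, and the straight-line homotopy to the constant loop y
   stays in R^n \ 0.  Lifting it gives x = x'.  Surjectivity is lifting of
   segments.  The inverse is C^k because its partial derivatives are the rows
   of (Df)^-1 composed with the inverse itself. *)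

From HB Require Import structures.
Require Import Defs.
From mathcomp Require Import ring lra zify.
From mathcomp Require finmap.

Set Implicit Arguments.
Unset Strict Implicit.
Unset Printing Implicit Defensive.

Import Order.TTheory GRing.Theory Num.Theory.
Import numFieldNormedType.Exports.

Local Open Scope classical_set_scope.
Local Open Scope ring_scope.

(** * Partial derivatives and differentiability *)

(** Lifting is carried out on finite grids rather than on continuous paths. What makes this work is
    a quantitative inverse function theorem: one number [d] controls injectivity and openness of [f]
    around a point, and it is uniform on compact sets of nonzero points. Paths and homotopies that
    avoid 0 have norms in some [[a, b]] with [a > 0]. Since [|f x|] grows like [|x|] to the power
    [kappa], everything that lies over them is contained in one compact annulus; a single [d]
    therefore serves for every lift, and a fine enough grid can be followed. The dimension enters
    only through the choice of m: each condition on m says that it avoids the span of two vectors,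
    and finitely many such spans do not fill R^n when n >= 3. In dimension 2 injectivity does fail,
    as z -> z^2 on the complex plane shows. The same constants make the inverse locally Lipschitz,
    and its differentiability rests on that bound. *)

Lemma normr_rV_le (R : realType) (n : nat) (v : 'rV[R]_n) (M : R) :
  0 <= M -> (forall i, `|v 0 i| <= M) -> `|v| <= M.
Proof.
move=> M0 vM; rewrite [leLHS]/Num.Def.normr/= mx_normrE.
by apply: bigmax_le => // -[i j] _ /=; rewrite ord1.
Qed.

Lemma normr_coord_le (R : realType) (n : nat) (v : 'rV[R]_n) i :
  `|v 0 i| <= `|v|.
Proof.
by rewrite [leRHS]/Num.Def.normr/= mx_normrE; exact: (le_bigmax _ _ (0, i)).
Qed.

Lemma normr_delta_mx (R : realType) (n : nat) (j : 'I_n) :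
  `|delta_mx 0 j : 'rV[R]_n| = 1.
Proof.
apply/eqP; rewrite eq_le; apply/andP; split.
  by apply: normr_rV_le => // i; rewrite mxE eqxx /=; case: eqP; rewrite ?normr1 ?normr0.
by apply: le_trans (normr_coord_le _ j); rewrite mxE !eqxx normr1.
Qed.

Lemma normr_mulmx_bound (R : realType) (n p : nat) (A : 'M[R]_(n, p)) :
  exists2 C : R, 0 < C & forall v : 'rV[R]_n, `|v *m A| <= C * `|v|.
Proof.
have C0 : 0 <= \sum_i \sum_j `|A i j| by rewrite !sumr_ge0 // => i _; rewrite sumr_ge0.
exists (1 + \sum_i \sum_j `|A i j|) => [|v]; first lra.
apply: normr_rV_le => [|j]; first by rewrite mulr_ge0 // addr_ge0.
rewrite mxE (le_trans (ler_norm_sum _ _ _)) //.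
apply: (@le_trans _ _ ((\sum_i \sum_j `|A i j|) * `|v|)).
  rewrite mulr_suml; apply: ler_sum => i _; rewrite normrM mulrC ler_pM //.
    by rewrite (bigD1 j) //= lerDl sumr_ge0.
  exact: normr_coord_le.
by rewrite ler_wpM2r // lerDr.
Qed.

Section staircase.
Variables (R : realType) (n : nat).
Implicit Types (x y a : 'rV[R]_n) (u : 'rV[R]_n -> R).

Lemma partial_line u x (j : 'I_n) (t : R) :
  derivable u (x + t *: delta_mx 0 j) (delta_mx 0 j) ->
  is_derive t 1 (fun s => u (x + s *: delta_mx 0 j))
    ('D_(delta_mx 0 j) u (x + t *: delta_mx 0 j)).
Proof.
have E : (fun h : R => h^-1 *: (u (x + (h *: 1 + t) *: delta_mx 0 j)
           - u (x + t *: delta_mx 0 j)))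
       = (fun h : R => h^-1 *: (u (h *: delta_mx 0 j + (x + t *: delta_mx 0 j))
           - u (x + t *: delta_mx 0 j))).
  apply/funext => h; congr (_ *: (u _ - _)).
  by rewrite scalerDl addrCA [h *: 1]mulr1.
by move=> du; split; rewrite /derivable /derive /= E.
Qed.

(** Mean value theorem along one coordinate direction. The two conditions on [t] say that it lies
    between 0 and [s], whatever the sign of [s]. *)
Lemma partial_increment u x (j : 'I_n) (s M : R) :
  (forall t : R, `|t| <= `|s| -> 0 <= t * s ->
     derivable u (x + t *: delta_mx 0 j) (delta_mx 0 j) /\
     `|'D_(delta_mx 0 j) u (x + t *: delta_mx 0 j)| <= M) ->
  `|u (x + s *: delta_mx 0 j) - u x| <= M * `|s|.
Proof.
move=> H.
pose phi (t : R) := u (x + t *: delta_mx 0 j).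
pose dphi (t : R) := 'D_(delta_mx 0 j) u (x + t *: delta_mx 0 j).
have phi0 : u x = phi 0 by rewrite /phi scale0r addr0.
have dP t : `|t| <= `|s| -> 0 <= t * s -> is_derive t 1 phi (dphi t).
  by move=> ts st; apply: partial_line; exact: (H t ts st).1.
have cP t : `|t| <= `|s| -> 0 <= t * s -> {for t, continuous phi}.
  move=> ts st; apply/differentiable_continuous/derivable1_diffP.
  by apply: ex_derive; exact: dP.
have itvP (a b : R) : a <= b -> (forall t, a <= t <= b -> `|t| <= `|s| /\ 0 <= t * s) ->
    exists2 c, (a <= c <= b) & phi b - phi a = dphi c * (b - a).
  move=> ab abs; have [||c] := @MVT_segment R phi dphi a b ab.
  - move=> t; rewrite in_itv /= => /andP[/ltW ta /ltW tb].
    by apply: dP; apply abs; rewrite ta.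
  - apply: continuous_in_subspaceT => t; rewrite inE /= in_itv /= => tab.
    by apply: cP; apply abs.
  - by rewrite in_itv /= => cab E; exists c.
have [s0|/ltW s0] := leP 0 s.
  have H2 t : 0 <= t <= s -> `|t| <= `|s| /\ 0 <= t * s.
    by move=> /andP[t0 ts]; rewrite !ger0_norm // mulr_ge0.
  have [c cs E] := itvP _ _ s0 H2.
  rewrite phi0 -/(phi s) E subr0 normrM ler_wpM2r //.
  by have [? ?] := H2 c cs; exact: (H c _ _).2.
have H2 t : s <= t <= 0 -> `|t| <= `|s| /\ 0 <= t * s.
  by move=> /andP[t0 ts]; rewrite !ler0_norm // lerN2 mulr_le0.
have [c cs E] := itvP _ _ s0 H2.
rewrite distrC phi0 -/(phi s) E sub0r normrM normrN ler_wpM2r //.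
by have [? ?] := H2 c cs; exact: (H c _ _).2.
Qed.

(** The coordinates of [x] are replaced by those of [y] one at a time: [z k] has the first [k] from
    [y] and the others from [x]. The norm is the maximum norm, so the ball is a box and contains the
    whole staircase; each of the [n] steps costs at most [M * |y - x|]. *)
Lemma partial_lipschitz u a (r M : R) : 0 <= M ->
  (forall x j, `|x - a| < r -> derivable u x (delta_mx 0 j) /\
     `|'D_(delta_mx 0 j) u x| <= M) ->
  forall x y, `|x - a| < r -> `|y - a| < r ->
    `|u y - u x| <= n%:R * M * `|y - x|.
Proof.
move=> M0 H x y xa ya.
pose z (k : nat) : 'rV[R]_n := \row_i if (i < k)%N then y 0 i else x 0 i.
have z0 : z 0%N = x by apply/rowP => i; rewrite mxE.
have zn : z n = y by apply/rowP => i; rewrite mxE ltn_ord.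
have zS (k : 'I_n) : z k.+1 = z k + (y 0 k - x 0 k) *: delta_mx 0 k.
  apply/rowP => i; rewrite !mxE eqxx /= ltnS leq_eqVlt.
  have [->|ik] := eqVneq i k; first by rewrite eqxx ltnn /= mulr1 addrC subrK.
  by rewrite mulr0 addr0; have -> : (i == k :> nat) = false by exact/negbTE.
have zline (k : 'I_n) (t : R) : `|t| <= `|y 0 k - x 0 k| ->
    0 <= t * (y 0 k - x 0 k) -> `|z k + t *: delta_mx 0 k - a| < r.
  move=> t1 t2; apply: le_lt_trans (_ : Num.max `|x - a| `|y - a| < r); last first.
    by rewrite gt_max xa.
  apply: normr_rV_le => [|i]; first by rewrite le_max normr_ge0.
  have cx : `|x 0 i - a 0 i| <= `|x - a|.
    by have := normr_coord_le (x - a) i; rewrite !mxE.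
  have cy : `|y 0 i - a 0 i| <= `|y - a|.
    by have := normr_coord_le (y - a) i; rewrite !mxE.
  rewrite !mxE eqxx /=; have [ik|ik] := eqVneq i k; last first.
    by rewrite mulr0 addr0 le_max; case: ifP => _; rewrite ?cx ?cy ?orbT.
  rewrite ik ltnn mulr1; rewrite {}ik in cx cy.
  set X := `|x - a| in cx *; set Y := `|y - a| in cy *.
  have XM : X <= Num.max X Y by rewrite le_max lexx.
  have YM : Y <= Num.max X Y by rewrite le_max lexx orbT.
  set M' := Num.max X Y in XM YM *.
  have {cx} : `|x 0 k - a 0 k| <= M' by exact: le_trans XM.
  have {cy} : `|y 0 k - a 0 k| <= M' by exact: le_trans YM.
  rewrite !ler_norml => /andP[? ?] /andP[? ?].
  have [d0|d0] := leP 0 (y 0 k - x 0 k).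
    have [t0|t0] := leP 0 t.
      by move: t1; rewrite !ger0_norm // => t1; apply/andP; split; lra.
    have e0 : y 0 k - x 0 k = 0 by nra.
    move: t1; rewrite e0 normr0 normr_le0 => /eqP t1; lra.
  have [t0|t0] := leP t 0.
    by move: t1; rewrite !ler0_norm // ?(ltW d0)// => t1; apply/andP; split; lra.
  nra.
have step (k : 'I_n) : `|u (z k.+1) - u (z k)| <= M * `|y - x|.
  rewrite zS; apply: le_trans (@partial_increment u (z k) k _ M _) _.
    by move=> t t1 t2; apply: H; exact: zline.
  by apply: ler_wpM2l => //; have := normr_coord_le (y - x) k; rewrite !mxE.
have -> : u y - u x = \sum_(i < n) (u (z i.+1) - u (z i)).
  by rewrite -(big_mkord xpredT (fun i => u (z i.+1) - u (z i))) telescope_sumr // zn z0.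
rewrite (le_trans (ler_norm_sum _ _ _)) //.
apply: le_trans (_ : \sum_(i < n) M * `|y - x| <= _); first exact: ler_sum.
by rewrite sumr_const card_ord -mulrA mulr_natl.
Qed.

Lemma partial_lipschitz_rV (p : nat) (f : 'rV[R]_n -> 'rV[R]_p) a (r M : R) : 0 <= M ->
  (forall x j, `|x - a| < r -> derivable f x (delta_mx 0 j) /\
     `|'D_(delta_mx 0 j) f x| <= M) ->
  forall x y, `|x - a| < r -> `|y - a| < r ->
    `|f y - f x| <= n%:R * M * `|y - x|.
Proof.
move=> M0 H x y xa ya; apply: normr_rV_le => [|i]; first by rewrite !mulr_ge0.
rewrite !mxE; apply: (@partial_lipschitz (fun z => f z 0 i) a r M) => // z j za.
have [d b] := H z j za; split; first by move/derivable_mxP : d => /(_ 0 i).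
apply: le_trans b.
by have := normr_coord_le ('D_(delta_mx 0 j) f z) i; rewrite derive_mx // mxE.
Qed.

End staircase.

Lemma mulmxr_continuous (R : realType) (n p : nat) (A : 'M[R]_(n, p)) :
  continuous (mulmxr A : 'rV[R]_n -> 'rV[R]_p).
Proof.
have [C C0 CP] := normr_mulmx_bound A.
apply: bounded_linear_continuous; apply/linear_boundedP.
near=> r => x /=; apply: le_trans (CP x) _; rewrite ler_wpM2r //.
Unshelve. all: by end_near. Qed.

Lemma is_diff_mulmxr (R : realType) (n p : nat) (A : 'M[R]_(n, p)) (x : 'rV[R]_n) :
  is_diff x (mulmxr A : 'rV[R]_n -> 'rV[R]_p) (mulmxr A).
Proof.
apply: DiffDef; first exact/linear_differentiable/mulmxr_continuous.
by rewrite diff_lin //; exact: mulmxr_continuous.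
Qed.

Lemma is_diff_approx (R : numFieldType) (V W : normedModType R) (f : V -> W)
    (L : {linear V -> W}) (a : V) : continuous L ->
  (forall e : R, 0 < e -> \forall h \near 0, `|f (h + a) - f a - L h| <= e * `|h|) ->
  is_diff a f L.
Proof.
move=> cL H.
have D : f \o shift a = cst (f a) + L +o_ 0 id.
  apply/eqaddoP => _/posnumP[e]; have := H e%:num [gt0 of e%:num].
  by apply: filterS => h; rewrite opprD addrA.
have LE := diff_unique cL D.
by apply: DiffDef => //; apply/diff_locallyP; rewrite LE.
Qed.

Lemma diff_approx (R : numFieldType) (V W : normedModType R) (f : V -> W) (a : V)
    (e : R) : differentiable f a -> 0 < e ->
  \forall h \near 0, `|f (h + a) - f a - 'd f a h| <= e * `|h|.
Proof.
move=> /diff_locallyP[_ /eqaddoP H] e0.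
by apply: filterS (H e e0) => h; rewrite opprD addrA.
Qed.

(** The Jacobian matrix in the convention for row vectors, which act from the left; it makes sense
    before [f] is known to be differentiable. *)
Definition partials (R : realType) (n p : nat) (f : 'rV[R]_n -> 'rV[R]_p)
  (x : 'rV[R]_n) : 'M[R]_(n, p) := \matrix_(j, l) ('D_(delta_mx 0 j) f x) 0 l.

Lemma row_partials (R : realType) (n p : nat) (f : 'rV[R]_n -> 'rV[R]_p) x j :
  delta_mx 0 j *m partials f x = 'D_(delta_mx 0 j) f x.
Proof. by rewrite -rowE; apply/rowP => l; rewrite !mxE. Qed.

Section differentiability.
Variables (R : realType) (n p : nat).

(** Subtracting the candidate differential leaves a map whose partial derivatives are small near
    [a], so the staircase estimate gives it a small Lipschitz constant there. *)
Lemma partials_differentiable (f : 'rV[R]_n -> 'rV[R]_p) (a : 'rV[R]_n) :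
  (forall j, \forall x \near a, derivable f x (delta_mx 0 j)) ->
  (forall j, {for a, continuous ('D_(delta_mx 0 j) f)}) ->
  is_diff a f (mulmxr (partials f a)).
Proof.
move=> df cf.
set L : {linear 'rV[R]_n -> 'rV[R]_p} := mulmxr (partials f a).
pose Lf : 'rV[R]_n -> 'rV[R]_p := L.
have Ld x : differentiable Lf x.
  by have := is_diff_mulmxr (partials f a) x; case.
have LD x v : 'D_v Lf x = L v.
  rewrite deriveE //; have := is_diff_mulmxr (partials f a) x.
  by case=> _ /(congr1 (fun h : 'rV[R]_n -> 'rV[R]_p => h v)).
apply: is_diff_approx; first exact: mulmxr_continuous.
(* The staircase multiplies the bound by [n], and [n * M <= e]; the added 1 keeps the denominator
   positive for [n = 0]. *)
move=> e e0; set M := e / (n%:R + 1).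
have n1 : 0 < n%:R + 1 :> R by rewrite ltr_wpDl.
have M0 : 0 < M by rewrite divr_gt0.
have : \forall x \near a, forall j : 'I_n, derivable f x (delta_mx 0 j) /\
    `|'D_(delta_mx 0 j) f x - 'D_(delta_mx 0 j) f a| <= M.
  near=> x; near: x; apply: filter_forall => j.
  have /cvgrPdist_le/(_ _ M0) cfj := cf j.
  near=> x; split.
    by near: x; exact: df.
  by rewrite distrC; near: x.
move=> /nbhs_ballP[r /= r0 rP].
have rP' x j : `|x - a| < r -> derivable (f - Lf) x (delta_mx 0 j) /\
    `|'D_(delta_mx 0 j) (f - Lf) x| <= M.
  move=> xa; have /rP/(_ j)[d b] : ball a r x by rewrite -ball_normE /= distrC.
  have dL : derivable Lf x (delta_mx 0 j) by exact: diff_derivable.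
  split; first exact: derivableB.
  by rewrite (deriveB d dL) LD /L /= row_partials.
have Lip := partial_lipschitz_rV (ltW M0) rP'.
near=> h.
rewrite [leLHS](_ : _ = `|(f - Lf) (h + a) - (f - Lf) a|); last first.
  congr (`|_|); rewrite -![(_ - _ : _ -> _) _]/(_ - _) /Lf /L /= /mulmxr mulmxDl.
  set u := f _; set v := f _.
  by apply/rowP => i; rewrite !mxE; ring.
apply: le_trans (Lip a (h + a) _ _) _.
- by rewrite subrr normr0.
- rewrite addrK; near: h.
  by apply/nbhs_ballP; exists r => //= h; rewrite -ball_normE /= sub0r normrN; exact.
rewrite addrK ler_wpM2r // /M mulrCA ler_piMr // ?ltW// ltr_pdivrMr // mul1r; lra.
Unshelve. all: by end_near. Qed.

End differentiability.

Lemma scalar_partials_differentiable (R : realType) (n : nat) (u : 'rV[R]_n -> R)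
    (a : 'rV[R]_n) :
  (forall j, \forall x \near a, derivable u x (delta_mx 0 j)) ->
  (forall j, {for a, continuous ('D_(delta_mx 0 j) u)}) ->
  differentiable u a.
Proof.
move=> du cu; pose f x : 'rV[R]_1 := \row_(i < 1) u x.
have uE : u = (fun M : 'rV[R]_1 => M 0 0) \o f by apply/funext => x /=; rewrite mxE.
have fE i : (fun x => f x 0 i) = u by apply/funext => x; rewrite mxE.
have fD x v : derivable u x v -> derivable f x v.
  by move=> d; apply/derivable_mxP => i j; rewrite ord1 fE.
have df j : \forall x \near a, derivable f x (delta_mx 0 j).
  by have := du j; apply: filter_app; near=> x => /fD.
rewrite uE; apply: differentiable_comp; last exact: differentiable_coord.
suff : is_diff a f (mulmxr (partials f a)) by case.
apply: partials_differentiable => j; first exact: df.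
have E : \forall x \near a, 'D_(delta_mx 0 j) f x = \row_(i < 1) 'D_(delta_mx 0 j) u x.
  have := df j; apply: filter_app; near=> x => d.
  by rewrite (derive_mx d); apply/matrixP => i k; rewrite !mxE ord1 fE.
suff : 'D_(delta_mx 0 j) f x @[x --> a] --> 'D_(delta_mx 0 j) f a by [].
rewrite (nbhs_singleton E).
apply/(@cvgrPdist_le _ _ _ (nbhs a)) => e e0; have /cvgrPdist_le/(_ _ e0) := cu j.
apply: filterS2 E => x -> H.
by apply: normr_rV_le => [|i]; [exact: ltW | rewrite !mxE].
Unshelve. all: by end_near. Qed.

(** * The inverse function theorem with uniform constants *)

(* Provides the join of the normed and complete structures, missing for matrices. *)
HB.instance Definition _ (R : realType) (m n : nat) :=
  Uniform_isComplete.Build 'M[R]_(m, n) cauchy_cvg.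

(** Banach's theorem on a closed ball. Radius 0 is allowed because the radius will be proportional
    to [|y - f x|], which may vanish. *)
Lemma contraction_fixpoint (R : realType) (X : completeNormedModType R)
    (T : X -> X) (x : X) (e : R) : 0 <= e ->
  (forall z, `|z - x| <= e -> `|T z - x| <= e) ->
  (forall z z', `|z - x| <= e -> `|z' - x| <= e ->
     `|T z - T z'| <= 2^-1 * `|z - z'|) ->
  exists2 z, `|z - x| <= e & T z = z.
Proof.
move=> e0 Tx Tc; pose U := closed_ball_ Num.norm x e.
have UE z : U z <-> `|z - x| <= e by rewrite /U /closed_ball_ /= distrC.
have TU : set_fun U U T by move=> z /UE/Tx/UE.
pose TF : {fun U >-> U} := HB.pack T (isFun.Build X X U U T TU).
have [|||z Uz zE] := @banach_fixed_point R X U TF; last 1 first.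
- by exists z; [exact/UE | rewrite {2}zE].
- have h0 : 0 <= 2^-1 :> R by [].
  exists (NngNum h0); split => /=; first by rewrite invf_lt1 // ltr1n.
  by move=> [z z'] [/= /UE uz /UE uz'] /=; exact: Tc.
- exact: closed_closed_ball_.
- by exists x; apply/UE; rewrite subrr normr0.
Qed.

Section local_inverse.
Variables (R : realType) (n : nat) (U : set 'rV[R]_n) (f : 'rV[R]_n -> 'rV[R]_n).
Implicit Types (a x y z : 'rV[R]_n) (d e : R).

(* One constant serves as radius, as lower Lipschitz and openness constant and,
   inverted, as upper one: the condition only gets weaker as d decreases, so that
   compactness makes d uniform. *)
Definition quant_inv d x :=
  (forall x', `|x' - x| < d -> [/\ U x', d * `|x' - x| <= `|f x' - f x|
     & `|f x' - f x| <= d^-1 * `|x' - x|]) /\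
  (forall e y, 0 < e <= d -> `|y - f x| < d * e ->
     exists2 z, `|z - x| < e & f z = y).

Hypothesis U_open : open U.
Hypothesis df : forall x j, U x -> derivable f x (delta_mx 0 j).
Hypothesis cdf : forall x j, U x -> {for x, continuous ('D_(delta_mx 0 j) f)}.

Lemma is_diff_partials x : U x -> is_diff x f (mulmxr (partials f x)).
Proof.
move=> Ux; apply: partials_differentiable => j; last exact: cdf.
by have := open_nbhs_nbhs (conj U_open Ux); apply: filterS => z; exact: df.
Qed.

(** The quasi-Newton map [x - f x *m invmx (partials f a)] has zero derivative at [a], hence an
    arbitrarily small Lipschitz constant close to [a]. *)
Lemma quasi_newton_lipschitz a (M : R) : U a -> partials f a \in unitmx -> 0 < M ->
  exists2 r, 0 < r & forall x x', `|x - a| < r -> `|x' - a| < r ->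
    [/\ U x, U x' & `|(x' - f x' *m invmx (partials f a))
       - (x - f x *m invmx (partials f a))| <= M * `|x' - x|].
Proof.
move=> Ua Ju M0; set B := invmx _.
have [C C0 CP] := normr_mulmx_bound B.
pose g := (id - (mulmxr B \o f)) : 'rV[R]_n -> 'rV[R]_n.
(* The derivative of g vanishes at a. *)
have dg x j : U x -> is_derive x (delta_mx 0 j) g
    (delta_mx 0 j - 'D_(delta_mx 0 j) f x *m B).
  move=> Ux; have dfx := is_diff_partials Ux.
  have dB := is_diff_mulmxr B (f x).
  have dgx : is_diff x g (id - (mulmxr B \o mulmxr (partials f x))).
    apply: is_diffB.
  split; first by apply: diff_derivable; case: dgx.
  rewrite deriveE; last by case: dgx.
  have -> : 'd g x = (id - (mulmxr B \o mulmxr (partials f x))) :> (_ -> _).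
    by case: dgx.
  by rewrite -[(_ - _ : _ -> _) _]/(_ - _) /= row_partials.
(* Partials of [f] that vary by at most [C^-1 * N] give partials of [g] bounded by [N], since [B]
   expands by at most [C]; the staircase then yields [n * N <= M]. *)
pose N := M / (n%:R + 1).
have n1 : 0 < n%:R + 1 :> R by rewrite ltr_wpDl.
have N0 : 0 < N by rewrite divr_gt0.
have : \forall x \near a, U x /\ forall j : 'I_n,
    `|'D_(delta_mx 0 j) f a - 'D_(delta_mx 0 j) f x| <= C^-1 * N.
  near=> x; split; first by near: x; exact: open_nbhs_nbhs.
  near: x; apply: filter_forall => j.
  have /cvgrPdist_le := @cdf a j Ua; apply; by rewrite mulr_gt0 // invr_gt0.
move=> /nbhs_ballP[r /= r0 rP].
have rP' x : `|x - a| < r -> U x /\ forall j : 'I_n,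
    `|'D_(delta_mx 0 j) f a - 'D_(delta_mx 0 j) f x| <= C^-1 * N.
  by move=> xa; apply: rP; rewrite -ball_normE /= distrC.
exists r => // x x' xa x'a; split; [exact: (rP' _ xa).1|exact: (rP' _ x'a).1|].
apply: le_trans (@partial_lipschitz_rV R n n g a r N (ltW N0) _ x x' xa x'a) _.
  move=> z j za; have [Uz zP] := rP' z za.
  have dgz := dg z j Uz; split => //; rewrite derive_val.
  have eE : delta_mx 0 j = 'D_(delta_mx 0 j) f a *m B.
    by rewrite -row_partials -mulmxA mulmxV // mulmx1.
  rewrite {1}eE -mulmxBl; apply: le_trans (CP _) _.
  apply: (@le_trans _ _ (C * (C^-1 * N))).
    apply: ler_wpM2l; first exact: ltW.
    exact: (zP j).
  by rewrite mulVKf // gt_eqF.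
rewrite ler_wpM2r // /N mulrCA ler_piMr // ?ltW// ltr_pdivrMr // mul1r; lra.
Unshelve. all: by end_near. Qed.

(** Let the quasi-Newton map have Lipschitz constant 1/2. Writing [x' - x] as its increment plus
    [(f x' - f x) *m B] gives the lower bound, and multiplying back by [J] the upper one. For
    openness, [z - f z *m B + y *m B] is a contraction whose fixed points are the solutions of
    [f z = y]. *)
Lemma near_quant_inv a : U a -> partials f a \in unitmx ->
  \forall x \near a & d \near 0^'+, quant_inv d x.
Proof.
move=> Ua Ju; set J := partials f a in Ju *.
have h0 : 0 < 2^-1 :> R by [].
have [r r0 rP] := quasi_newton_lipschitz Ua Ju h0.
set B := invmx _ in rP.
have [C C0 CP] := normr_mulmx_bound B.
have [K K0 KP] := normr_mulmx_bound J.
(* [r / 2] keeps the [d]-ball around [x] inside the [r]-ball around [a]; [(2 * C)^-1] serves the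
   lower bound and openness, [(K * 2)^-1] the upper bound. *)
pose D := Num.min (r / 2) (Num.min (2 * C)^-1 (K * 2)^-1).
have D0 : 0 < D by rewrite !lt_min !invr_gt0 !mulr_gt0 // divr_gt0.
exists (ball a (r / 2), [set d | 0 < d < D]) => [|[x d] /= [xa /andP[d0 dD]]].
  split; first by apply: nbhsx_ballx; rewrite divr_gt0.
  by near=> d; apply/andP; split.
have [dr [dC dK]] : d < r / 2 /\ d < (2 * C)^-1 /\ d < (K * 2)^-1.
  by move: dD; rewrite !lt_min => /and3P[].
have {}xa : `|x - a| < r / 2 by move: xa; rewrite -ball_normE /= distrC.
have xr : `|x - a| < r by lra.
have near_a x' : `|x' - x| <= d -> `|x' - a| < r.
  move=> x'x; have := ler_normD (x' - x) (x - a); rewrite subrKA; lra.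
split=> [x' x'x|e y /andP[e0 ed] yfx].
  have x'r := near_a x' (ltW x'x).
  have [Ux Ux' L] := rP x x' xr x'r; split => //.
    have E : x' - x = ((x' - f x' *m B) - (x - f x *m B)) + (f x' - f x) *m B.
      by rewrite mulmxBl; apply/rowP => i; rewrite !mxE; ring.
    have := ler_normD ((x' - f x' *m B) - (x - f x *m B)) ((f x' - f x) *m B).
    rewrite -E => H; have := CP (f x' - f x) => H2.
    apply: (@le_trans _ _ ((2 * C)^-1 * `|x' - x|)).
      by rewrite ler_wpM2r // ltW.
    rewrite ler_pdivrMl ?mulr_gt0 //; lra.
  have E : f x' - f x = ((x' - x) - ((x' - f x' *m B) - (x - f x *m B))) *m J.
    have -> : (x' - x) - ((x' - f x' *m B) - (x - f x *m B)) = (f x' - f x) *m B.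
      by rewrite mulmxBl; apply/rowP => i; rewrite !mxE; ring.
    by rewrite -mulmxA mulVmx // mulmx1.
  rewrite E; apply: le_trans (KP _) _.
  have := ler_normB (x' - x) ((x' - f x' *m B) - (x - f x *m B)) => H.
  apply: (@le_trans _ _ (K * 2 * `|x' - x|)).
    by have := normr_ge0 (x' - x); rewrite -mulrA ler_pM2l //; lra.
  rewrite ler_wpM2r // -[leLHS]invrK lef_pV2 ?posrE ?invr_gt0 ?mulr_gt0 //; exact: ltW.
(* On the closed ball of this radius [T] is a self-map: [T] moves the centre by at most
   [C * d * e' <= e' / 2] and contracts by 1/2. As [e' < e], the fixed point satisfies the strict
   bound. *)
pose e' := `|y - f x| / d.
have e'0 : 0 <= e' by rewrite divr_ge0 // ltW.
have e'e : e' < e by rewrite ltr_pdivrMr // mulrC.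
pose T z := (z - f z *m B) + y *m B.
have Tlip z z' : `|z - x| <= e' -> `|z' - x| <= e' -> `|T z - T z'| <= 2^-1 * `|z - z'|.
  move=> zx z'x.
  have -> : T z - T z' = (z - f z *m B) - (z' - f z' *m B).
    by rewrite /T; apply/rowP => i; rewrite !mxE; ring.
  have zr : `|z - a| < r by apply: near_a; lra.
  have z'r : `|z' - a| < r by apply: near_a; lra.
  by have [] := rP z' z z'r zr.
have [z|z zx Tz] := contraction_fixpoint e'0 _ Tlip.
  move=> zx; have xx : `|x - x| <= e' by rewrite subrr normr0.
  have H1 := Tlip z x zx xx.
  have H2 : `|T x - x| <= 2^-1 * e'.
    have -> : T x - x = (y - f x) *m B.
      by rewrite /T mulmxBl; apply/rowP => i; rewrite !mxE; ring.
    apply: le_trans (CP _) _.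
    have -> : `|y - f x| = e' * d by rewrite /e' divfK // gt_eqF.
    rewrite mulrCA [leRHS]mulrC ler_wpM2l // -ler_pdivlMl //.
    by rewrite -invfM mulrC ltW.
  have := ler_normD (T z - T x) (T x - x); rewrite subrKA; lra.
exists z; first exact: le_lt_trans e'e.
have : (y - f z) *m B = 0.
  rewrite mulmxBl; apply/eqP; rewrite subr_eq0; apply/eqP.
  move: Tz; rewrite /T => /(congr1 (fun w => w - z + f z *m B)); rewrite subrr add0r => <-.
  by apply/rowP => i; rewrite !mxE; ring.
move=> /(congr1 (fun w => w *m J)); rewrite -mulmxA mulVmx // mulmx1 mul0mx.
by move=> /eqP; rewrite subr_eq0 => /eqP.
Unshelve. all: by end_near. Qed.

End local_inverse.

(** * Lifting through a local homeomorphism along a grid *)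

Lemma compact_quant_inv (R : realType) (n : nat) (U : set 'rV[R]_n)
    (f : 'rV[R]_n -> 'rV[R]_n) (A : set 'rV[R]_n) : compact A ->
  (forall x, A x -> \forall x \near x & d \near 0^'+, quant_inv U f d x) ->
  exists2 d : R, 0 < d & forall x, A x -> quant_inv U f d x.
Proof.
move=> /compact_near_coveringP cA AP.
have H : \forall d \near 0^'+, A `<=` quant_inv U f d.
  exact: (cA R (0^'+) (fun d x => quant_inv U f d x) _ AP).
have [d [Hd dgt]] : exists d : R, A `<=` quant_inv U f d /\ 0 < d.
  by apply: (@filter_ex _ (0^'+)); apply: filterI => //; exact: nbhs_right_gt.
by exists d.
Qed.

Section discrete_lifting.
Variables (R : realType) (n : nat) (U A : set 'rV[R]_n) (f : 'rV[R]_n -> 'rV[R]_n).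
Variable d : R.
Hypothesis d0 : 0 < d.
Hypothesis Ad : forall x, A x -> quant_inv U f d x.

Lemma quant_inv_inj x x' : A x -> `|x' - x| < d -> f x' = f x -> x' = x.
Proof.
move=> Ax xd E; have [_ + _] := (Ad Ax).1 x' xd.
rewrite E subrr normr0 => H; apply/eqP; rewrite -subr_eq0 -normr_le0.
by rewrite -(pmulr_rle0 _ d0).
Qed.

(** Every point over [c i] lies in [A], where openness with radius [d] reaches all values within
    [d * d], in particular [c i.+1]. *)
Lemma discrete_path_lift (N : nat) (c : nat -> 'rV[R]_n) :
  (forall i x, (i <= N)%N -> U x -> f x = c i -> A x) ->
  (forall i, (i < N)%N -> `|c i.+1 - c i| < d * d) ->
  (exists2 x, U x & f x = c 0%N) -> exists2 x, U x & f x = c N.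
Proof.
move=> cA cd x0.
suff H i : (i <= N)%N -> exists2 x, U x & f x = c i by exact: H.
elim: i => [//|i IH iN]; have [x Ux fx] := IH (ltnW iN).
have qx := Ad (cA i x (ltnW iN) Ux fx).
have [||z zx fz] := qx.2 d (c i.+1).
- by rewrite lexx d0.
- by rewrite fx; exact: cd.
by exists z => //; have [] := qx.1 z zx.
Qed.

(* Rows of the grid are lifted downwards from j = M, each lift moving by less than
   e; neighbouring lifts then stay e-close, because two points over the same value
   at distance < 4 e <= d coincide. *)
Lemma discrete_homotopy_lift (N M : nat) (H : nat -> nat -> 'rV[R]_n)
    (y : 'rV[R]_n) (z : nat -> 'rV[R]_n) (e : R) :
  0 < e -> 4 * e <= d ->
  (forall i j x, (i <= N)%N -> (j <= M)%N -> U x -> f x = H i j -> A x) ->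
  (forall i j, (i < N)%N -> (j <= M)%N -> `|H i.+1 j - H i j| < d * e) ->
  (forall i j, (i <= N)%N -> (j < M)%N -> `|H i j.+1 - H i j| < d * e) ->
  (forall j, (j <= M)%N -> H 0%N j = y) ->
  (forall j, (j <= M)%N -> H N j = y) ->
  (forall i, (i <= N)%N -> H i 0%N = y) ->
  (forall i, (i <= N)%N -> U (z i) /\ f (z i) = H i M) ->
  (forall i, (i < N)%N -> `|z i.+1 - z i| < e) ->
  z 0%N = z N.
Proof.
move=> e0 ed HA Hs Ht H0 HN Hb zH ze.
have e1 : 0 < e <= d by rewrite e0 /=; lra.
suff lift j : (j <= M)%N -> exists w : nat -> 'rV[R]_n, [/\ w 0%N = z 0%N, w N = z N,
    forall i, (i <= N)%N -> U (w i) /\ f (w i) = H i (M - j)%N &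
    forall i, (i < N)%N -> `|w i.+1 - w i| < e].
  have [w [w0 wN wH we]] := lift M (leqnn M).
  (* The bottom row of the homotopy is constantly [y], so neighbouring lifts there are close points
     over the same value and coincide. *)
  suff w_const i : (i <= N)%N -> w i = w 0%N by rewrite -w0 -wN w_const.
  elim: i => [//|i IH iN]; rewrite -(IH (ltnW iN)).
  have [Uw fw] := wH i (ltnW iN); have [Uw' fw'] := wH i.+1 iN.
  rewrite subnn in fw fw'; apply: quant_inv_inj.
  - exact: HA (ltnW iN) (leq0n M) Uw fw.
  - by apply: lt_le_trans (we i iN) _; lra.
  - by rewrite fw fw' !Hb // ltnW.
elim: j => [_|j IH jM]; first by exists z; split => // i iN; rewrite subn0; exact: zH.
have [w [w0 wN wH we]] := IH (ltnW jM).
have Mj : (M - j = (M - j.+1).+1)%N by lia.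
rewrite {}Mj in wH; set k := (M - j.+1)%N in wH *.
have kM : (k < M)%N by rewrite /k; lia.
have wA i : (i <= N)%N -> A (w i).
  by move=> iN; have [Uw fw] := wH i iN; exact: HA iN kM Uw fw.
have : forall i, exists v, (i <= N)%N -> [/\ `|v - w i| < e, U v & f v = H i k].
  move=> i; have [iN|iN] := leqP i N; last by exists 0.
  have qw := Ad (wA i iN).
  have [|v vw fv] := qw.2 e (H i k) e1.
    by rewrite (wH i iN).2 distrC; exact: Ht.
  exists v => _; split => //.
  by have [] := qw.1 v _ => //; apply: lt_le_trans vw _; lra.
move=> /choice[v vP].
have vA i : (i <= N)%N -> A (v i).
  by move=> iN; have [_ Uv fv] := vP i iN; exact: HA iN (ltnW kM) Uv fv.
exists v; split.
- have [vw Uv fv] := vP 0%N isT; rewrite -w0; apply: quant_inv_inj; first exact: wA.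
    by apply: lt_le_trans vw _; lra.
  by rewrite fv (wH 0%N isT).2 !H0 // ltnW.
- have [vw Uv fv] := vP N (leqnn N); rewrite -wN; apply: quant_inv_inj; first exact: wA.
    by apply: lt_le_trans vw _; lra.
  by rewrite fv (wH N (leqnn N)).2 !HN // ltnW.
- by move=> i iN; have [] := vP i iN.
- move=> i iN; have [vw Uv fv] := vP i (ltnW iN); have [vw' Uv' fv'] := vP i.+1 iN.
  have qv := Ad (vA i (ltnW iN)).
  have [|t tv ft] := qv.2 e (H i.+1 k) e1; first by rewrite fv; apply: Hs => //; exact: ltnW.
  suff <- : t = v i.+1 by [].
  apply: quant_inv_inj; first exact: vA.
    have wi := we i iN.
    have -> : t - v i.+1 = (t - v i) + (v i - w i) - (w i.+1 - w i) - (v i.+1 - w i.+1).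
      by apply/rowP => l; rewrite !mxE; ring.
    apply: le_lt_trans (ler_normB _ _) _.
    have := ler_normB (t - v i + (v i - w i)) (w i.+1 - w i).
    have := ler_normD (t - v i) (v i - w i); lra.
  by rewrite ft fv'.
Qed.

End discrete_lifting.

(** * Bijectivity of homogeneous local homeomorphisms *)

(** The first [size p] natural numbers are distinct in [R], one more than the degree of [p] allows
    as roots. *)
Lemma poly_exists_nonroot (R : numDomainType) (p : {poly R}) :
  p != 0 -> exists x : R, ~~ root p x.
Proof.
move=> p0; apply: contrapT => H.
pose s := [seq (i%:R : R) | i <- iota 0 (size p)].
have us : uniq s.
  by rewrite map_inj_in_uniq ?iota_uniq // => i j _ _ /eqP; rewrite eqr_nat => /eqP.
have rs : all (root p) s.
  by apply/allP => x _; apply: contrapT => xr; apply: H; exists x; apply/negP.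
by have := max_poly_roots p0 rs us; rewrite size_map size_iota ltnn.
Qed.

(* On the moment curve a linear form is a polynomial in the parameter, so the
   curve meets each hyperplane in finitely many points. *)
Lemma exists_avoiding_planes (R : numFieldType) (n : nat) :
  (3 <= n)%N -> forall s : seq ('rV[R]_n * 'rV[R]_n),
  exists m : 'rV[R]_n, forall p, p \in s ->
    forall a b : R, m <> a *: p.1 + b *: p.2.
Proof.
move=> n3 s.
(* Two vectors have rank at most 2, which is less than [n], so some nonzero linear form kills
   both. *)
have normal (v b : 'rV[R]_n) :
    exists2 c : 'cV[R]_n, c != 0 & v *m c = 0 /\ b *m c = 0.
  have : cokermx (col_mx v b) != 0.
    rewrite -mxrank_eq0 mxrank_coker subn_eq0 -ltnNge.
    exact: leq_ltn_trans (rank_leq_row _) n3.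
  move=> /eqP H; have [j Hj] : exists j, col j (cokermx (col_mx v b)) != 0.
    apply: contrapT => Hn; apply: H; apply/matrixP => i j; rewrite !mxE.
    have /negP : ~ col j (cokermx (col_mx v b)) != 0 by move=> ?; apply: Hn; exists j.
    by rewrite negbK => /eqP/colP/(_ i); rewrite !mxE.
  exists (col j (cokermx (col_mx v b))) => //.
  have := mulmx_coker (col_mx v b); rewrite mul_col_mx => E.
  have E' : col_mx (v *m cokermx (col_mx v b)) (b *m cokermx (col_mx v b)) = col_mx 0 0.
    by rewrite E col_mx0.
  have [E1 E2] := eq_col_mx E'.
  have Ecol (Q : 'M[R]_n) (w : 'rV[R]_n) : w *m Q = 0 -> w *m col j Q = 0.
    by rewrite colE mulmxA => ->; rewrite mul0mx.
  by split; apply: Ecol.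
have : forall p : 'rV[R]_n * 'rV[R]_n, exists c : 'cV[R]_n,
    [/\ c != 0, p.1 *m c = 0 & p.2 *m c = 0].
  by move=> p; have [c c0 [? ?]] := normal p.1 p.2; exists c.
move=> /choice[c cP].
pose P p : {poly R} := \poly_(i < n) (if insub i is Some j then c p j 0 else 0).
have coefP p (i : 'I_n) : (P p)`_i = c p i 0.
  by rewrite coef_poly ltn_ord insubT //= => h; congr (c p _ 0); apply: val_inj.
have P0 p : P p != 0.
  have [+ _ _] := cP p; apply: contra => /eqP E; apply/eqP/colP => i.
  by rewrite -coefP E coef0 mxE.
(* A parameter outside the roots of the product avoids all the planes at once. *)
have [t tP] : exists t : R, ~~ root (\prod_(p <- s) P p) t.
  by apply: poly_exists_nonroot; rewrite prodf_seq_neq0; apply/allP => p _; rewrite P0.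
exists (\row_(i < n) t ^+ i) => p ps a b E.
move: tP; rewrite /root horner_prod (big_rem p) //= mulf_eq0 negb_or => /andP[/eqP + _].
apply.
have -> : (P p).[t] = ((\row_(i < n) t ^+ i) *m c p) 0 0.
  rewrite mxE (@horner_coef_wide _ n) ?size_poly //.
  by apply: eq_bigr => i _; rewrite coefP mxE mulrC.
have [_ c1 c2] := cP p.
by rewrite E mulmxDl -!scalemxAl c1 c2 !scaler0 addr0 mxE.
Qed.

Lemma compact_annulus (R : realType) (n : nat) (a b : R) :
  compact [set x : 'rV[R]_n | a <= `|x| <= b].
Proof.
apply: bounded_closed_compact.
  apply: filter_app (nbhs_pinfty_ge (num_real b)); near=> M => bM x /= /andP[_ xb].
  exact: le_trans bM.
rewrite (_ : mkset _ = [set x | a <= `|x|] `&` [set x | `|x| <= b]); last first.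
  by apply/seteqP; split => x /= => [/andP[]|[-> ->]].
apply: closedI.
  apply: (@preimage_closed _ _ (fun x : 'rV[R]_n => `|x|) [set t | a <= t]).
    by move=> x _; exact: norm_continuous.
  exact: closed_ge.
apply: (@preimage_closed _ _ (fun x : 'rV[R]_n => `|x|) [set t | t <= b]).
  by move=> x _; exact: norm_continuous.
exact: closed_le.
Unshelve. all: by end_near. Qed.

(** Finitely many balls of radius [d / 2] cover [A], and each contains at most one point of [F]; [g]
    lists that point, or nothing. *)
Lemma uniq_near_finite (R : realType) (n : nat) (A F : set 'rV[R]_n) (d : R) :
  0 < d -> compact A -> F `<=` A ->
  (forall x x', F x -> F x' -> `|x' - x| < d -> x' = x) ->
  exists s : seq 'rV[R]_n, (forall x, F x -> x \in s) /\ (forall x, x \in s -> F x).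
Proof.
move=> d0; rewrite compact_cover => cA FA Fd.
have [||D' _ AD'] := cA _ A (fun x => ball x (d / 2)).
- by move=> x _; exact: ball_open.
- by move=> x Ax; exists x => //; apply: ballxx; rewrite divr_gt0.
pose g x := if pselect (exists y, F y /\ ball x (d / 2) y) is left h
  then [:: projT1 (cid h)] else [::].
exists (flatten [seq g x | x <- finmap.enum_fset D']); split => [z Fz|z].
  have [x /= xD' xz] := AD' z (FA z Fz).
  apply/flatten_mapP; exists x => //; rewrite /g; case: pselect => [h|]; last by case; exists z.
  case: (cid h) => w /= [Fw xw]; rewrite inE; apply/eqP; apply: Fd => //.
  move: xz xw; rewrite -!ball_normE /= => xz xw.
  have -> : z - w = (x - w) - (x - z) by apply/rowP => i; rewrite !mxE; ring.
  have := ler_normB (x - w) (x - z); lra.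
move=> /flatten_mapP[x _]; rewrite /g; case: pselect => // h.
by case: (cid h) => w /= [Fw xw]; rewrite inE => /eqP ->.
Qed.

Lemma open_nonzero (R : realType) (n : nat) : open [set~ (0 : 'rV[R]_n)].
Proof.
exact/closed_openC/accessible_closed_set1/hausdorff_accessible/norm_hausdorff.
Qed.

(** Extrema of [|h|] on the unit sphere, carried to all radii by homogeneity. The extremal points
    are returned instead of the values, so that the lower bound becomes positive as soon as [h] is
    known to have no zero. *)
Lemma homogeneous_sphere_bounds (R : realType) (n : nat) (a : R)
    (h : 'rV[R]_n -> 'rV[R]_n) : (0 < n)%N -> pos_homogeneous a h ->
  (forall x : 'rV[R]_n, x != 0 -> {for x, continuous h}) ->
  exists u v : 'rV[R]_n, [/\ u != 0, v != 0 & forall x : 'rV[R]_n, x != 0 ->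
    `|h u| * `|x| `^ a <= `|h x| <= `|h v| * `|x| `^ a].
Proof.
move=> n0 h_homog h_cont; pose S := [set x : 'rV[R]_n | 1 <= `|x| <= 1].
have cS : compact S by exact: compact_annulus.
have S0 : S !=set0.
  by exists (delta_mx 0 (Ordinal n0)); rewrite /S /= normr_delta_mx lexx.
have SU x : S x -> x != 0.
  by rewrite /S /= => /andP[x1 _]; rewrite -normr_gt0; lra.
have ch : {within S, continuous (fun x => `|h x|)}.
  apply: continuous_in_subspaceT => x /set_mem/SU x0; have hx := h_cont x x0.
  exact: (@cvg_norm _ _ _ _ _ _ _ hx).
have [u uS uP] := compact_EVT_min S0 cS ch.
have [v vS vP] := compact_EVT_max S0 cS ch.
rewrite inE in uS; rewrite inE in vS.
exists u, v; split; [exact: SU|exact: SU|move=> x x0].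
have nx : 0 < `|x| by rewrite normr_gt0.
have Su : S (`|x|^-1 *: x).
  by rewrite /S /= normrZ normfV normr_id mulVf ?gt_eqF // lexx.
have -> : `|h x| = `|h (`|x|^-1 *: x)| * `|x| `^ a.
  have nx0 : `|x| != 0 by rewrite gt_eqF.
  rewrite -{1}[x](scalerKV nx0) h_homog // ?SU // normrZ.
  by rewrite ger0_norm ?powR_ge0 // mulrC.
by rewrite !ler_wpM2r ?powR_ge0 // ?uP ?vP // inE.
Qed.

(** Away from 0 the extension agrees locally with [h]; at 0 the upper bound [|h v| * |z|] to the
    power [a] tends to 0 because [a > 0]. *)
Lemma continuous_extend0 (R : realType) (n : nat) (a : R)
    (h : 'rV[R]_n -> 'rV[R]_n) : (0 < n)%N -> 0 < a -> pos_homogeneous a h ->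
  (forall x : 'rV[R]_n, x != 0 -> {for x, continuous h}) -> continuous (extend0 h).
Proof.
move=> n0 a0 h_homog h_cont x; have [->|x0] := eqVneq x 0; last first.
  have hx := h_cont x x0.
  have E : \forall z \near x, h z = extend0 h z.
    have : nbhs x [set~ 0].
      apply: open_nbhs_nbhs; split; [exact: open_nonzero | exact/eqP].
    by apply: filterS => z /eqP/negbTE z0; rewrite /extend0 z0.
  suff : extend0 h z @[z --> x] --> extend0 h x by [].
  rewrite -(nbhs_singleton E); apply: cvg_trans hx.
  by apply: (@near_eq_cvg _ _ (nbhs x)); apply: filterS E => z ->.
have [u [v [u0 v0 H]]] := homogeneous_sphere_bounds n0 h_homog h_cont.
suff : extend0 h z @[z --> (0 : 'rV[R]_n)] --> extend0 h 0 by [].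
apply/(@cvgrPdist_lt _ _ _ (nbhs (0 : 'rV[R]_n))) => e e0.
have v1 : 0 < `|h v| + 1 by rewrite ltr_wpDl.
pose d := (e / (`|h v| + 1)) `^ a^-1.
have d0 : 0 < d by rewrite powR_gt0 // divr_gt0.
apply/nbhs_ballP; exists d => //= z; rewrite -ball_normE /= sub0r normrN => zd.
rewrite {1}/extend0 eqxx sub0r normrN /extend0; have [_|z0] := eqVneq z 0.
  by rewrite normr0.
have /andP[_ hz] := H z z0; apply: le_lt_trans hz _.
have da : d `^ a = e / (`|h v| + 1).
  by rewrite /d -powRrM mulVf ?gt_eqF // powRr1 // divr_ge0 // ltW.
have za : `|z| `^ a < e / (`|h v| + 1).
  by rewrite -da; apply: gt0_ltr_powR => //; rewrite nnegrE // ltW.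
apply: le_lt_trans (_ : (`|h v| + 1) * `|z| `^ a < e).
  by rewrite ler_wpM2r ?powR_ge0 // lerDl.
by rewrite mulrC -ltr_pdivlMr.
Qed.

Lemma max0_dist (R : realDomainType) (a b : R) :
  `|Num.max a 0 - Num.max b 0| <= `|a - b|.
Proof.
have : - `|a - b| <= a - b <= `|a - b| by rewrite -ler_norml.
move=> /andP[h1 h2]; rewrite ler_norml.
by case: (leP a 0) => ?; case: (leP b 0) => ?; apply/andP; split; lra.
Qed.

Lemma nat_ndiv_lt (R : realType) (B e : R) :
  0 < e -> exists2 N : nat, (0 < N)%N & B / N%:R < e.
Proof.
move=> e0; exists (Num.trunc (B / e)).+1 => //.
by rewrite ltr_pdivrMr // mulrC -ltr_pdivrMr // truncnS_gt.
Qed.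

Section homogeneous_bijection.
Variables (R : realType) (n : nat) (kappa : R) (f : 'rV[R]_n -> 'rV[R]_n).
Hypothesis n_ge3 : (3 <= n)%N.
Hypothesis kappa_gt0 : 0 < kappa.
Hypothesis f_homog : pos_homogeneous kappa f.
Hypothesis f_cont : forall x : 'rV[R]_n, x != 0 -> {for x, continuous f}.
Implicit Types (x y z v w : 'rV[R]_n).
Let U : set 'rV[R]_n := [set~ 0].
Hypothesis f_inv : forall x : 'rV[R]_n, x != 0 ->
  \forall x' \near x & d \near 0^'+, quant_inv U f d x'.

Lemma nonzero_quant_inv x : x != 0 -> exists2 d, 0 < d & quant_inv U f d x.
Proof.
move=> x0; have := @compact_quant_inv R n U f [set x] (@compact_set1 _ x).
by case=> [_ ->|d d0 H]; [exact: f_inv|exists d => //; exact: H].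
Qed.

Lemma homogeneous_neq0 x : x != 0 -> f x != 0.
Proof.
move=> x0; apply/eqP => fx0; have [d d0 qd] := nonzero_quant_inv x0.
have nx : 0 < `|x| by rewrite normr_gt0.
(* With this [s] the point [x'] on the ray of [x] is at distance [d / 2] from [x], within the radius
   of injectivity. *)
pose s := d / (2 * `|x|); have s0 : 0 < s by rewrite divr_gt0 // mulr_gt0.
pose x' := (1 + s) *: x.
have x'x : x' - x = s *: x by rewrite /x' scalerDl scale1r addrAC subrr add0r.
have nx' : `|x' - x| = d / 2.
  by rewrite x'x normrZ gtr0_norm // /s; field; rewrite gt_eqF.
have : x' = x.
  have qd' z : [set x] z -> quant_inv U f d z by move=> ->.
  apply: (quant_inv_inj d0 qd' (erefl x)).
    by rewrite nx'; lra.
  by rewrite /x' f_homog // ?fx0 ?scaler0 //; lra.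
by move/eqP; rewrite -subr_eq0 -normr_eq0 nx' => /eqP; lra.
Qed.

Lemma homogeneous_growth : exists c C : R, [/\ 0 < c, 0 < C &
  forall x, x != 0 -> c * `|x| `^ kappa <= `|f x| <= C * `|x| `^ kappa].
Proof.
have [u [v [u0 v0 H]]] := homogeneous_sphere_bounds (ltnW (ltnW n_ge3)) f_homog f_cont.
by exists `|f u|, `|f v|; split; rewrite ?normr_gt0 ?homogeneous_neq0.
Qed.

(** Solving the two-sided growth bound for [|x|] puts the preimage in an annulus; [a > 0] makes its
    inner radius positive. *)
Lemma homogeneous_proper (a b : R) : 0 < a ->
  exists A : set 'rV[R]_n, [/\ compact A, (forall x, A x -> x != 0) &
    forall x, x != 0 -> a <= `|f x| <= b -> A x].
Proof.
move=> a0; have [c [C [c0 C0 H]]] := homogeneous_growth.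
exists [set x | (a / C) `^ kappa^-1 <= `|x| <= (b / c) `^ kappa^-1]; split.
- exact: compact_annulus.
- move=> x /= /andP[ax _]; rewrite -normr_gt0; apply: lt_le_trans ax.
  by rewrite powR_gt0 // divr_gt0.
move=> x x0 /andP[afx fxb] /=; have /andP[cx Cx] := H x x0.
have k0 : 0 <= kappa^-1 by rewrite invr_ge0 ltW.
have xE : `|x| = (`|x| `^ kappa) `^ kappa^-1.
  by rewrite -powRrM divff ?gt_eqF // powRr1.
have [xC xc] : a / C <= `|x| `^ kappa /\ `|x| `^ kappa <= b / c.
  by rewrite ler_pdivrMr // ler_pdivlMr // ![`|x| `^ _ * _]mulrC; split; lra.
rewrite xE; apply/andP; split.
  by apply: ge0_ler_powR => //; rewrite nnegrE ?powR_ge0 // divr_ge0 // ltW.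
apply: ge0_ler_powR => //; rewrite nnegrE ?powR_ge0 //.
exact: le_trans (powR_ge0 _ _) xc.
Qed.

Lemma proper_quant_inv (a b : R) : 0 < a ->
  exists (A : set 'rV[R]_n) (d : R), [/\ compact A, 0 < d,
    forall x, A x -> quant_inv U f d x &
    forall x, x != 0 -> a <= `|f x| <= b -> A x].
Proof.
move=> a0; have [A [cA A0 AP]] := homogeneous_proper b a0.
have [d d0 dP] := compact_quant_inv cA (fun x Ax => f_inv (A0 x Ax)).
by exists A, d.
Qed.

(** The norm on the segment has a positive minimum and a maximum, so one [d] is valid over all of
    it; the segment is cut into steps shorter than [d * d]. *)
Lemma segment_in_range (y0 y1 : 'rV[R]_n) :
  (forall t : R, 0 <= t <= 1 -> y0 + t *: (y1 - y0) != 0) ->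
  (exists2 x, x != 0 & f x = y0) -> exists2 x, x != 0 & f x = y1.
Proof.
move=> seg0 x0; pose c (t : R) := y0 + t *: (y1 - y0).
have cc t : {for t, continuous (fun t => `|c t|)}.
  apply: cvg_norm; apply: cvgD; first exact: cvg_cst.
  exact: scalel_continuous.
have K0 : `[0 : R, 1] !=set0 by exists 0; rewrite /= in_itv /= lexx ler01.
have cK : compact (`[0 : R, 1] : set R) by exact: segment_compact.
have cw : {within `[0 : R, 1], continuous (fun t => `|c t|)}.
  by apply: continuous_in_subspaceT => t _; exact: cc.
have [ta taK aP] := compact_EVT_min K0 cK cw.
have [tb _ bP] := compact_EVT_max K0 cK cw.
have a0 : 0 < `|c ta|.
  by rewrite normr_gt0 seg0 //; move: taK; rewrite inE /= in_itv.
have [A [d [_ d0 dP AP]]] := proper_quant_inv `|c tb| a0.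
have [N N0 NP] := nat_ndiv_lt `|y1 - y0| (mulr_gt0 d0 d0).
have tK i : (i <= N)%N -> (i%:R / N%:R : R) \in (`[0, 1]%classic : set R).
  move=> iN; rewrite inE /= in_itv /= divr_ge0 //=.
  by rewrite ler_pdivrMr ?ltr0n // mul1r ler_nat.
have := @discrete_path_lift R n U A f d d0 dP N (fun i => c (i%:R / N%:R)).
case.
- move=> i x iN Ux fx; apply: AP; first exact/eqP.
  by rewrite fx aP ?bP // tK.
- move=> i iN; apply: le_lt_trans NP.
  have -> : c (i.+1%:R / N%:R) - c (i%:R / N%:R) = N%:R^-1 *: (y1 - y0).
    rewrite /c opprD addrACA subrr add0r -scalerBl -mulrBl -natr1.
    by rewrite addrAC subrr add0r mul1r.
  by rewrite normrZ ger0_norm ?invr_ge0 // mulrC.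
- by have [x /eqP Ux fx] := x0; exists x => //; rewrite mul0r /c scale0r addr0.
move=> x /eqP Ux; rewrite divff ?pnatr_eq0 -?lt0n // /c scale1r addrC subrK.
by exists x.
Qed.

(** The segment from a known value [f v] to [y] may pass through 0; the detour through [m], outside
    the span of [f v] and [y], does not. *)
Lemma homogeneous_surj y : y != 0 -> exists2 x, x != 0 & f x = y.
Proof.
(* The span of the pair [(0, 0)] is [{0}], so this only produces a nonzero vector. *)
move=> y0; have [v vP] := @exists_avoiding_planes R n n_ge3 [:: (0, 0)].
have v0 : v != 0.
  by apply/eqP => v0; apply: (vP _ (mem_head _ _) 0 0); rewrite v0 !scaler0 addr0.
have fv0 := homogeneous_neq0 v0.
have [m mP] := @exists_avoiding_planes R n n_ge3 [:: (f v, y)].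
have {}mP := mP _ (mem_head _ _).
apply: (@segment_in_range m).
  move=> t /andP[t0 t1]; apply/eqP => E.
  have [t1'|t1'] := eqVneq t 1.
    by move: E; rewrite t1' scale1r addrC subrK => /eqP; exact/negP.
  have t2 : 1 - t != 0 by rewrite subr_eq0 eq_sym.
  apply: (mP 0 (- (t / (1 - t)))); rewrite scale0r add0r /=.
  have -> : m = (1 - t)^-1 *: ((m + t *: (y - m)) - t *: y).
    by apply/rowP => i; rewrite !mxE; field.
  by rewrite E sub0r scalerN scalerA scaleNr mulrC.
apply: (@segment_in_range (f v)); last by exists v.
move=> t /andP[t0 t1]; apply/eqP => E.
have [t0'|t0'] := eqVneq t 0.
  by move: E; rewrite t0' scale0r addr0 => /eqP; exact/negP.
apply: (mP (- ((1 - t) / t)) 0); rewrite scale0r addr0 /=.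
have -> : m = t^-1 *: ((f v + t *: (m - f v)) - (1 - t) *: f v).
  by apply/rowP => i; rewrite !mxE; field.
by rewrite E sub0r scalerN scalerA scaleNr mulrC.
Qed.

(** The straight-line homotopy [H] contracts the loop [f (g s)] to [y]. It is sampled on a grid
    whose top row is lifted by [g] itself, and the discrete homotopy lifting identifies the two ends
    of that row. *)
Lemma loop_lift (g : R -> 'rV[R]_n) (L : R) (y : 'rV[R]_n) : 0 <= L ->
  (forall s t, `|g s - g t| <= L * `|s - t|) ->
  (forall s, -1 <= s <= 1 -> g s != 0) ->
  f (g (-1)) = y -> f (g 1) = y ->
  (forall s t, -1 <= s <= 1 -> 0 <= t <= 1 -> y + t *: (f (g s) - y) != 0) ->
  g (-1) = g 1.
Proof.
move=> L0 gL g0 gy0 gy1 H0.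
have L1 : 0 < L + 1 by lra.
have gc s : {for s, continuous g}.
  apply/cvgrPdist_lt => e e0; near=> t.
  apply: le_lt_trans (gL _ _) _.
  apply: le_lt_trans (_ : (L + 1) * `|s - t| < e).
    by rewrite ler_wpM2r //; lra.
  rewrite mulrC -ltr_pdivlMr //; near: t.
  apply: (@cvgr_dist_lt _ _ _ (nbhs s) _ id s); first exact: cvg_id.
  by rewrite divr_gt0.
pose H (s t : R) := y + t *: (f (g s) - y).
pose K := `[-1 : R, 1]%classic `*` `[0 : R, 1]%classic.
have inK r u : K (r, u) <-> -1 <= r <= 1 /\ 0 <= u <= 1.
  by rewrite /K /= !in_itv /=.
have K0 : K !=set0 by exists (0, 0); apply/inK; lra.
have cK : compact K by apply: compact_setX; exact: segment_compact.
have cH : {within K, continuous (fun p : R * R => `|H p.1 p.2|)}.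
  apply: continuous_in_subspaceT => -[s t]; rewrite inE => /inK[s1 t1].
  apply: cvg_norm; apply: cvgD; first exact: cvg_cst.
  apply: cvgZ; first exact: cvg_snd.
  apply: cvgB; last exact: cvg_cst.
  apply: (@cvg_comp _ _ _ fst (f \o g) _ (nbhs s)); first exact: cvg_fst.
  exact: (@continuous_comp _ _ _ g f s (gc s) (f_cont (g0 s s1))).
have [pa paK aP] := compact_EVT_min K0 cK cH.
have [pb _ bP] := compact_EVT_max K0 cK cH.
set a := `|H pa.1 pa.2| in aP; set b := `|H pb.1 pb.2| in bP.
have a0 : 0 < a.
  by move: paK; rewrite inE [pa]surjective_pairing => /inK[? ?]; rewrite normr_gt0 H0.
have ab s t : -1 <= s <= 1 -> 0 <= t <= 1 -> a <= `|H s t| <= b.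
  have HK : -1 <= s <= 1 -> 0 <= t <= 1 -> (s, t) \in K by move=> ? ?; rewrite inE; apply/inK.
  by move=> s1 t1; rewrite (aP (s, t)) ?(bP (s, t)) // HK.
have [A [d [_ d0 dP AP]]] := proper_quant_inv b a0.
pose e := d / 4; have e0 : 0 < e by rewrite divr_gt0.
have de0 : 0 < d * e by rewrite mulr_gt0.
(* [N1] keeps neighbouring points of [g] within [e], and [N2] keeps their images within [d * e], as
   [f] expands by at most [d^-1] there; the product [N1 * N2] serves both. The factor 2 in [2 * L]
   is the length of [[-1, 1]], and [2 * b] bounds the length of each homotopy segment. *)
have [N1 N10 N1P] := nat_ndiv_lt (2 * L) e0.
have [N2 N20 N2P] := nat_ndiv_lt (d^-1 * (2 * L)) de0.
have [M M0 MP] := nat_ndiv_lt (2 * b) de0.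
have N0 : (0 < N1 * N2)%N by rewrite muln_gt0 N10.
set N := (N1 * N2)%N in N0.
have ler_div (B : R) k l : 0 <= B -> (0 < k)%N -> (0 < l)%N -> B / (k * l)%:R <= B / k%:R.
  move=> B0 k0 l0; rewrite ler_wpM2l // lef_pV2 ?posrE ?ltr0n ?muln_gt0 ?k0 //.
  by rewrite ler_nat leq_pmulr.
have {}N1P : 2 * L / N%:R < e by apply: le_lt_trans N1P; apply: ler_div => //; lra.
have {}N2P : d^-1 * (2 * L) / N%:R < d * e.
  apply: le_lt_trans N2P; rewrite /N mulnC; apply: ler_div => //.
  by rewrite mulr_ge0 ?invr_ge0 ?(ltW d0) // mulr_ge0.
pose s (i : nat) : R := -1 + 2 * (i%:R / N%:R); pose t (j : nat) : R := j%:R / M%:R.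
have frac (k i : nat) : (0 < k)%N -> (i <= k)%N -> 0 <= (i%:R / k%:R : R) <= 1.
  move=> k0 ik; rewrite divr_ge0 //= ler_pdivrMr ?ltr0n // mul1r ler_nat //.
have s1 i : (i <= N)%N -> -1 <= s i <= 1.
  by move=> /(frac _ _ N0); rewrite /s; lra.
have t1 j : (j <= M)%N -> 0 <= t j <= 1 by exact: frac.
have sS i : s i.+1 - s i = 2 / N%:R.
  by rewrite /s -natr1; field; rewrite pnatr_eq0 -lt0n.
have tS j : t j.+1 - t j = M%:R^-1.
  by rewrite /t -natr1; field; rewrite pnatr_eq0 -lt0n.
have s00 : s 0%N = -1 by rewrite /s mul0r mulr0 addr0.
have sN : s N = 1 by rewrite /s divff ?pnatr_eq0 -?lt0n //; ring.
have Hs1 r : H r 1 = f (g r) by rewrite /H scale1r addrC subrK.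
have gstep i : `|g (s i.+1) - g (s i)| <= 2 * L / N%:R.
  apply: le_trans (gL _ _) _; rewrite sS ger0_norm ?divr_ge0 //.
  by rewrite mulrA [L * 2]mulrC.
have gA i : (i <= N)%N -> A (g (s i)).
  move=> iN; apply: AP; first by apply: g0; exact: s1.
  by rewrite -Hs1; apply: ab; [exact: s1 | lra].
have := @discrete_homotopy_lift R n U A f d d0 dP N M (fun i j => H (s i) (t j)) y
  (fun i => g (s i)) e e0.
rewrite s00 sN; apply.
- by rewrite /e; lra.
- move=> i j x iN jM Ux fx; apply: AP; first exact/eqP.
  by rewrite fx; apply: ab; [exact: s1|exact: t1].
- move=> i j iN jM; have tj := t1 j jM.
  have -> : H (s i.+1) (t j) - H (s i) (t j) = t j *: (f (g (s i.+1)) - f (g (s i))).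
    by rewrite /H; apply/rowP => l; rewrite !mxE; ring.
  rewrite normrZ ger0_norm; last by lra.
  apply: le_lt_trans (_ : `|f (g (s i.+1)) - f (g (s i))| < _).
    by rewrite ler_piMl //; lra.
  have [|_ _ fb] := (dP _ (gA i (ltnW iN))).1 (g (s i.+1)).
    by apply: le_lt_trans (gstep i) _; rewrite /e in N1P; lra.
  apply: le_lt_trans fb _; apply: le_lt_trans N2P; rewrite -mulrA ler_wpM2l //.
  by rewrite invr_ge0 ltW.
- move=> i j iN jM.
  have -> : H (s i) (t j.+1) - H (s i) (t j) = M%:R^-1 *: (H (s i) 1 - H (s i) 0).
    by rewrite -(tS j) /H; apply/rowP => l; rewrite !mxE; ring.
  rewrite normrZ ger0_norm ?invr_ge0 //; apply: le_lt_trans MP.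
  rewrite mulrC ler_wpM2r ?invr_ge0 //.
  have := ler_normB (H (s i) 1) (H (s i) 0).
  have /andP[_ ?] := ab (s i) 1 (s1 i iN) ltac:(lra).
  have /andP[_ ?] := ab (s i) 0 (s1 i iN) ltac:(lra).
  lra.
- by move=> j _; rewrite /= /H ?s00 gy0 subrr scaler0 addr0.
- by move=> j _; rewrite /= /H ?sN gy1 subrr scaler0 addr0.
- by move=> i _; rewrite /= /H /t mul0r scale0r addr0.
- move=> i iN; split; first by apply/eqP; apply: g0; exact: s1.
  by rewrite /t divff ?Hs1 // pnatr_eq0 -lt0n.
- by move=> i iN; exact: le_lt_trans (gstep i) N1P.
Unshelve. all: by end_near. Qed.

(** The points over [- y] lie in a compact annulus and are [d]-separated, hence finite in number,
    and a point mapped to a negative multiple of [y] is a positive multiple of one of them. If the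
    homotopy vanished over [g r], then [g r] would be such a point on a segment from [x] or [x'] to
    [m]. It is not the end over [y], so [m] would lie in one of the avoided planes. *)
Lemma homogeneous_inj x x' : x != 0 -> x' != 0 -> f x = f x' -> x = x'.
Proof.
move=> x0 x'0 fE; set y := f x in fE *; have y0 : y != 0 by exact: homogeneous_neq0.
have ny0 : 0 < `|y| by rewrite normr_gt0.
have [A [d [cA d0 dP AP]]] := proper_quant_inv `|y| ny0.
pose F := [set z | z != 0 /\ f z = - y].
have FA : F `<=` A.
  by move=> z [z0 fz]; apply: AP => //; rewrite fz normrN lexx.
have [|s [sF Fs]] := @uniq_near_finite R n A F d d0 cA FA.
  move=> z z' Fz [z'0 fz'] zz'; apply: (quant_inv_inj d0 dP) (FA z Fz) zz' _.
  by rewrite fz'; case: Fz.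
(* The pairs [(x, x)] and [(x', x')] stand for lines and keep the path away from 0; the other pairs
   span planes with the points over [- y]. *)
pose S := (x, x) :: (x', x') :: [seq (x, b) | b <- s] ++ [seq (x', b) | b <- s].
have [m mP] := @exists_avoiding_planes R n n_ge3 S.
have m1 v a b : v = x \/ v = x' -> m <> a *: v + b *: v.
  case=> ->; [apply: (mP (x, x)) | apply: (mP (x', x'))].
    exact: mem_head.
  by rewrite inE mem_head orbT.
have m2 v w a b : v = x \/ v = x' -> F w -> m <> a *: v + b *: w.
  move=> vx /sF ws; apply: (mP (v, w)); rewrite !inE mem_cat.
  by case: vx => ->; rewrite map_f ?orbT.
(* The broken line from [x] at -1 through [m] at 0 to [x'] at 1 in a single formula; its
   coefficients are 1-Lipschitz in [s], which gives the Lipschitz constant of the path at once. *)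
pose g (s : R) := Num.max (- s) 0 *: x + Num.max s 0 *: x' + (1 - `|s|) *: m.
have gside r : -1 <= r <= 1 -> exists v c, [/\ v = x \/ v = x', 0 <= c <= 1 &
    g r = c *: v + (1 - c) *: m].
  move=> r1; have [r0|r0] := leP 0 r.
    exists x', r; split; [by right| lra |].
    by rewrite /g ger0_norm // max_r ?max_l ?scale0r ?add0r //; lra.
  exists x, (- r); split; [by left| lra |].
  rewrite /g ltr0_norm // max_l ?[Num.max r 0]max_r ?scale0r ?addr0 //; lra.
have vx0 v : v = x \/ v = x' -> v != 0 /\ f v = y by case=> ->; split.
have gx : g (-1) = x.
  by rewrite /g opprK normrN normr1 subrr scale0r max_l ?max_r ?scale1r ?scale0r ?addr0 //; lra.
have gx' : g 1 = x'.
  by rewrite /g normr1 subrr scale0r max_r ?max_l ?scale1r ?scale0r ?addr0 ?add0r //; lra.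
have gs0 r : -1 <= r <= 1 -> g r != 0.
  move=> /gside[v [c [vx c01 ->]]]; have [v0 _] := vx0 v vx; apply/eqP => E.
  have [c1|c1] := eqVneq c 1.
    by move: E; rewrite c1 subrr scale0r addr0 scale1r => /eqP; exact/negP.
  have c2 : 1 - c != 0 by rewrite subr_eq0 eq_sym.
  apply: (m1 v (- (c / (1 - c))) 0 vx); rewrite scale0r addr0.
  have -> : m = (1 - c)^-1 *: ((c *: v + (1 - c) *: m) - c *: v).
    by apply/rowP => i; rewrite !mxE; field.
  by rewrite E sub0r scalerN scalerA scaleNr mulrC.
rewrite -gx -gx'; apply: (@loop_lift g (`|x| + `|x'| + `|m|) y).
- by rewrite !addr_ge0.
- move=> r t.
  have -> : g r - g t = (Num.max (- r) 0 - Num.max (- t) 0) *: x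
      + (Num.max r 0 - Num.max t 0) *: x' + (`|t| - `|r|) *: m.
    by rewrite /g; apply/rowP => i; rewrite !mxE; ring.
  have step (a : R) (v : 'rV[R]_n) : `|a| <= `|r - t| -> `|a *: v| <= `|v| * `|r - t|.
    by move=> ar; rewrite normrZ mulrC ler_wpM2l.
  rewrite !mulrDl; apply: le_trans (ler_normD _ _) _; apply: lerD.
    apply: le_trans (ler_normD _ _) _; apply: lerD; apply: step.
      by apply: le_trans (max0_dist _ _) _; rewrite -opprD normrN.
    exact: max0_dist.
  by apply: step; rewrite distrC; exact: ler_dist_dist.
- exact: gs0.
- by rewrite gx.
- by rewrite gx' -fE.
move=> r t r1 /andP[t0 t1]; apply/eqP => E.
have [t0'|t0'] := eqVneq t 0.
  by move: E; rewrite t0' scale0r addr0 => /eqP; exact/negP.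
have tp : 0 < t by rewrite lt_def t0'.
pose c := (1 - t) / t.
have fgr : f (g r) = - c *: y.
  have -> : f (g r) = t^-1 *: ((y + t *: (f (g r) - y)) - (1 - t) *: y).
    by apply/rowP => i; rewrite !mxE; field.
  by rewrite E sub0r scalerN scalerA scaleNr mulrC.
(* The value [c = 0] is the case [t = 1], where [f] would vanish at [g r]. *)
have cp : 0 < c.
  have : 0 <= c by rewrite divr_ge0 //; lra.
  rewrite le_eqVlt => /orP[/eqP c0|//].
  have := homogeneous_neq0 (gs0 r r1).
  by rewrite fgr -c0 oppr0 scale0r eqxx.
(* Dividing [g r] by [q] divides its image by [c], so [w] lies exactly over [- y]. *)
pose q := c `^ kappa^-1; have q0 : 0 < q by rewrite powR_gt0.
have qk : q `^ kappa = c.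
  by rewrite /q -powRrM mulVf ?gt_eqF // powRr1 // ltW.
pose w := q^-1 *: g r.
have gw : g r = q *: w by rewrite /w scalerA divff ?gt_eqF // scale1r.
have w0 : w != 0 by apply: contra (gs0 r r1) => /eqP w0; rewrite gw w0 scaler0.
have Fw : F w.
  split=> //; have : c *: f w = c *: (- y).
    by rewrite -{1}qk -f_homog // -gw fgr scalerN scaleNr.
  by move=> /(scalerI (_ : c != 0)); apply; rewrite gt_eqF.
have [v [a [vx a01 gv]]] := gside r r1.
have [v0 fv] := vx0 v vx.
have [a1|a1] := eqVneq a 1.
  have grv : g r = v by rewrite gv a1 subrr scale0r addr0 scale1r.
  have : (1 + c) *: y == 0.
    by rewrite scalerDl scale1r -{1}fv -grv fgr scaleNr addNr.
  by rewrite scaler_eq0 (negbTE y0) orbF; apply/negP; rewrite gt_eqF //; lra.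
have a2 : 1 - a != 0 by rewrite subr_eq0 eq_sym.
apply: (m2 v w (- (a / (1 - a))) (q / (1 - a)) vx Fw).
have -> : m = (1 - a)^-1 *: ((a *: v + (1 - a) *: m) - a *: v).
  by apply/rowP => i; rewrite !mxE; field.
by rewrite -gv gw scalerBr !scalerA scaleNr addrC ![(1 - a)^-1 * _]mulrC.
Qed.
End homogeneous_bijection.

(** * Algebra of C^m functions *)

Section Cn_on_vector.
Variables (R : realType) (n : nat) (U : set 'rV[R]_n) (U_open : open U).

Lemma Cn_on_cont (W : normedModType R) m (f : 'rV[R]_n -> W) :
  Cn_on U m f -> forall x, U x -> {for x, continuous f}.
Proof. by case: m => [|m] []. Qed.

Lemma near_open (P : set 'rV[R]_n) x : U x -> U `<=` P -> \forall z \near x, P z.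
Proof. by move=> Ux UP; apply: filterS UP _; exact: open_nbhs_nbhs. Qed.

(** Differentiation formulas hold only at points of [U]; this lets them replace the actual
    derivatives in the inductions on the order below. *)
Lemma Cn_on_ext (W : normedModType R) m (f g : 'rV[R]_n -> W) :
  (forall x, U x -> f x = g x) -> Cn_on U m f -> Cn_on U m g.
Proof.
elim: m f g => [|m IH] f g fg [cf df].
  split=> // x Ux.
  have nfg : \forall z \near x, f z = g z by exact: near_open.
  suff : g z @[z --> x] --> g x by [].
  rewrite -(nbhs_singleton nfg); apply: cvg_trans (cf x Ux).
  by apply: (@near_eq_cvg _ _ (nbhs x)); apply: filterS nfg => z ->.
have nfg x : U x -> \forall z \near x, f z = g z by move=> Ux; exact: near_open.
split=> [x Ux|j].
  suff : g z @[z --> x] --> g x by [].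
  rewrite -(nbhs_singleton (nfg x Ux)); apply: cvg_trans (cf x Ux).
  by apply: (@near_eq_cvg _ _ (nbhs x)); apply: filterS (nfg x Ux) => z ->.
have [dfj cdf] := df j; split=> [x Ux|].
  by apply: near_eq_derivable (dfj x Ux); exact: nfg.
by apply: IH cdf => x Ux; apply: near_eq_derive; exact: nfg.
Qed.

Lemma Cn_onS (W : normedModType R) m (f : 'rV[R]_n -> W) :
  Cn_on U m.+1 f -> Cn_on U m f.
Proof.
elim: m f => [|m IH] f [cf df]; split => // j.
by have [d c] := df j; split=> //; exact: IH.
Qed.

Lemma Cn_on_derive (W : normedModType R) m (f : 'rV[R]_n -> W) j :
  Cn_on U m.+1 f -> Cn_on U m ('D_(delta_mx 0 j) f).
Proof. by case=> _ /(_ j)[]. Qed.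

Lemma Cn_on_derivable (W : normedModType R) m (f : 'rV[R]_n -> W) j x :
  Cn_on U m.+1 f -> U x -> derivable f x (delta_mx 0 j).
Proof. by case=> _ /(_ j)[+ _]; apply. Qed.

Lemma Cn_on_cst (W : normedModType R) m (w : W) : Cn_on U m (fun=> w).
Proof.
have cw (v : W) x : U x -> {for x, continuous (fun=> v : W)} by move=> _; exact: cst_continuous.
elim: m w => [|m IH] w; first by split=> // x; exact: cw.
split=> [x|j]; first exact: cw.
split=> [x _|]; first exact: derivable_cst.
by apply: Cn_on_ext (IH 0) => x _; rewrite derive_cst.
Qed.

Lemma Cn_onD (W : normedModType R) m (f g : 'rV[R]_n -> W) :
  Cn_on U m f -> Cn_on U m g -> Cn_on U m (fun x => f x + g x).
Proof.
elim: m f g => [|m IH] f g Hf Hg.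
  by split => // x Ux; exact: (cvgD (Cn_on_cont Hf Ux) (Cn_on_cont Hg Ux)).
split=> [x Ux|j]; first by exact: (cvgD (Cn_on_cont Hf Ux) (Cn_on_cont Hg Ux)).
split=> [x Ux|].
  exact: (derivableD (Cn_on_derivable Hf Ux) (Cn_on_derivable Hg Ux)).
apply: Cn_on_ext (IH _ _ (Cn_on_derive j Hf) (Cn_on_derive j Hg)) => x Ux.
rewrite -[RHS]/('D_(delta_mx 0 j) (f + g) x).
by rewrite (deriveD (Cn_on_derivable Hf Ux) (Cn_on_derivable Hg Ux)).
Qed.

Lemma Cn_on_sum (W : normedModType R) m (I : Type) (r : seq I) (P : pred I)
    (F : I -> 'rV[R]_n -> W) :
  (forall i, P i -> Cn_on U m (F i)) ->
  Cn_on U m (fun x => \sum_(i <- r | P i) F i x).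
Proof.
move=> FP; elim: r => [|i r IH].
  by apply: Cn_on_ext (Cn_on_cst m 0) => x _; rewrite big_nil.
have [Pi|Pi] := boolP (P i); last first.
  by apply: Cn_on_ext IH => x _; rewrite big_cons (negbTE Pi).
by apply: Cn_on_ext (Cn_onD (FP i Pi) IH) => x _; rewrite big_cons Pi.
Qed.

Lemma Cn_onM m (f g : 'rV[R]_n -> R) :
  Cn_on U m f -> Cn_on U m g -> Cn_on U m (fun x => f x * g x).
Proof.
elim: m f g => [|m IH] f g Hf Hg.
  by split => // x Ux; exact: (cvgM (Cn_on_cont Hf Ux) (Cn_on_cont Hg Ux)).
split=> [x Ux|j]; first by exact: (cvgM (Cn_on_cont Hf Ux) (Cn_on_cont Hg Ux)).
split=> [x Ux|].
  exact: (derivableM (Cn_on_derivable Hf Ux) (Cn_on_derivable Hg Ux)).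
apply: Cn_on_ext (Cn_onD (IH _ _ (Cn_onS Hf) (Cn_on_derive j Hg))
  (IH _ _ (Cn_onS Hg) (Cn_on_derive j Hf))) => x Ux.
rewrite -[RHS]/('D_(delta_mx 0 j) (f * g) x).
by rewrite (deriveM (Cn_on_derivable Hf Ux) (Cn_on_derivable Hg Ux)).
Qed.

Lemma Cn_on_prod m (I : Type) (r : seq I) (P : pred I) (F : I -> 'rV[R]_n -> R) :
  (forall i, P i -> Cn_on U m (F i)) ->
  Cn_on U m (fun x => \prod_(i <- r | P i) F i x).
Proof.
move=> FP; elim: r => [|i r IH].
  have c1 : Cn_on U m (fun=> 1 : R) by exact: Cn_on_cst.
  by apply: Cn_on_ext c1 => x _; rewrite big_nil.
have [Pi|Pi] := boolP (P i); last first.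
  by apply: Cn_on_ext IH => x _; rewrite big_cons (negbTE Pi).
by apply: Cn_on_ext (Cn_onM (FP i Pi) IH) => x _; rewrite big_cons Pi.
Qed.

Lemma Cn_onV m (f : 'rV[R]_n -> R) : (forall x, U x -> f x != 0) ->
  Cn_on U m f -> Cn_on U m (fun x => (f x)^-1).
Proof.
move=> f0; elim: m => [|m IH] Hf.
  by split => // x Ux; exact: (cvgV (f0 x Ux) (Cn_on_cont Hf Ux)).
split=> [x Ux|j]; first by exact: (cvgV (f0 x Ux) (Cn_on_cont Hf Ux)).
split=> [x Ux|].
  exact: (derivableV (f0 x Ux) (Cn_on_derivable Hf Ux)).
have IH' := IH (Cn_onS Hf).
have cN : Cn_on U m (fun=> -1 : R) by exact: Cn_on_cst.
apply: Cn_on_ext (Cn_onM cN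
  (Cn_onM (Cn_onM IH' IH') (Cn_on_derive j Hf))) => x Ux.
rewrite (deriveV (f0 x Ux) (Cn_on_derivable Hf Ux)).
by rewrite mulN1r scaleNr -exprVn expr2.
Qed.

Lemma Cn_on_mx m (p : nat) (f : 'rV[R]_n -> 'rV[R]_p) :
  Cn_on U m f <-> forall i, Cn_on U m (fun x => f x 0 i).
Proof.
split.
  move=> Hf i.
  have coordc k (h : 'rV[R]_n -> 'rV[R]_p) x : Cn_on U k h -> U x ->
      {for x, continuous (fun x => h x 0 i)}.
    move=> Hh Ux; have hc := Cn_on_cont Hh Ux.
    exact: (continuous_comp hc (@coord_continuous R 1 p 0 i (h x))).
  elim: m f Hf => [|m IH] f Hf; first by split=> // x; exact: coordc Hf.
  split=> [x|j]; first exact: coordc Hf.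
  have dfj x : U x -> derivable f x (delta_mx 0 j) by move=> Ux; exact: Cn_on_derivable Hf Ux.
  split=> [x Ux|]; first by move: (dfj x Ux) => /derivable_mxP/(_ 0 i).
  apply: Cn_on_ext (IH _ (Cn_on_derive j Hf)) => x Ux.
  by rewrite derive_mx ?mxE //; exact: dfj.
have mxc k (h : 'rV[R]_n -> 'rV[R]_p) x :
    (forall i, Cn_on U k (fun x => h x 0 i)) -> U x -> {for x, continuous h}.
  move=> Hh Ux; apply/(@cvgrPdist_le _ _ _ (nbhs x)) => e e0.
  near=> z; apply: normr_rV_le => [|i]; first exact: ltW.
  rewrite !mxE; move: i; near: z; apply: filter_forall => i.
  by have /cvgrPdist_le/(_ _ e0) := Cn_on_cont (Hh i) Ux.
elim: m f => [|m IH] f Hf; first by split=> // x; exact: mxc Hf.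
split=> [x|j]; first exact: mxc Hf.
have dfj x : U x -> derivable f x (delta_mx 0 j).
  move=> Ux; apply/derivable_mxP => i l; rewrite ord1; exact: Cn_on_derivable (Hf l) Ux.
split=> //; apply: IH => i.
apply: Cn_on_ext (Cn_on_derive j (Hf i)) => x Ux.
by rewrite derive_mx ?mxE //; exact: dfj.
Unshelve. all: by end_near. Qed.

Lemma Cn_on_det m (p : nat) (A : 'rV[R]_n -> 'M[R]_p) :
  (forall i j, Cn_on U m (fun x => A x i j)) -> Cn_on U m (fun x => \det (A x)).
Proof.
move=> HA; apply: Cn_on_sum => s _; apply: Cn_onM; first exact: Cn_on_cst.
by apply: Cn_on_prod => i _; exact: HA.
Qed.

(** Cramer's rule: the entries are cofactors divided by a determinant that does not vanish on
    [U]. *)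
Lemma Cn_on_invmx m (p : nat) (A : 'rV[R]_n -> 'M[R]_p) :
  (forall x, U x -> A x \in unitmx) ->
  (forall i j, Cn_on U m (fun x => A x i j)) ->
  forall i j, Cn_on U m (fun x => invmx (A x) i j).
Proof.
move=> Au HA i j.
have H : Cn_on U m (fun x => (\det (A x))^-1 * cofactor (A x) j i).
  apply: Cn_onM.
    apply: Cn_onV; last exact: Cn_on_det.
    by move=> x /Au; rewrite unitmxE unitfE.
  apply: Cn_onM; first exact: Cn_on_cst.
  by apply: Cn_on_det => k l; apply: Cn_on_ext (HA (lift j k) (lift i l)) => x _; rewrite !mxE.
by apply: Cn_on_ext H => x Ux; rewrite /invmx Au // !mxE.
Qed.

End Cn_on_vector.

Lemma Cn_on_differentiable (R : realType) (n : nat) (U : set 'rV[R]_n) m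
    (u : 'rV[R]_n -> R) x : open U ->
  Cn_on U m.+1 u -> U x -> differentiable u x.
Proof.
move=> U_open Hu Ux; apply: scalar_partials_differentiable => j.
  by apply: near_open Ux _ => // z Uz; exact: (Cn_on_derivable Hu Uz).
have H := Cn_on_cont (Cn_on_derive j Hu) Ux; exact: H.
Qed.

Lemma Cn_on_differentiable_rV (R : realType) (n p : nat) (U : set 'rV[R]_n) m
    (f : 'rV[R]_n -> 'rV[R]_p) x : open U ->
  Cn_on U m.+1 f -> U x -> is_diff x f (mulmxr (partials f x)).
Proof.
move=> U_open Hf Ux; apply: partials_differentiable => j.
  by apply: near_open Ux _ => // z Uz; exact: (Cn_on_derivable Hf Uz).
have H := Cn_on_cont (Cn_on_derive j Hf) Ux; exact: H.
Qed.

(** By the chain rule a partial derivative of the composite is a sum of partials of [g] times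
    partials of [u] taken at [g x]. The induction ranges over all [u] because it is applied again to
    these partials. *)
Lemma Cn_on_comp (R : realType) (n p : nat) (U : set 'rV[R]_n) (V : set 'rV[R]_p) m
    (g : 'rV[R]_n -> 'rV[R]_p) (u : 'rV[R]_p -> R) : open U -> open V ->
  (forall x, U x -> V (g x)) ->
  Cn_on U m g -> Cn_on V m u -> Cn_on U m (fun x => u (g x)).
Proof.
move=> U_open V_open gUV.
have cc k x (u' : 'rV[R]_p -> R) : U x -> Cn_on U k g -> Cn_on V k u' ->
    {for x, continuous (fun x => u' (g x))}.
  move=> Ux Hg Hu.
  have gc := Cn_on_cont Hg Ux; have uc := Cn_on_cont Hu (gUV x Ux).
  exact: (continuous_comp gc uc).
elim: m u => [|m IH] u Hg Hu; first by split=> // x Ux; exact: cc Ux Hg Hu.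
split=> [x Ux|j]; first exact: cc Ux Hg Hu.
have dg x : U x -> is_diff x g (mulmxr (partials g x)).
  by move=> Ux; exact: Cn_on_differentiable_rV U_open Hg Ux.
have du x : U x -> differentiable u (g x).
  by move=> Ux; exact: Cn_on_differentiable V_open Hu (gUV x Ux).
have dug x : U x -> differentiable (u \o g) x.
  by move=> Ux; apply: differentiable_comp; [case: (dg x Ux) | exact: du].
split=> [x Ux|]; first by apply: diff_derivable; exact: dug.
have H : Cn_on U m (fun x => \sum_(i < p)
    ('D_(delta_mx 0 j) g x 0 i) * ('D_(delta_mx 0 i) u (g x))).
  apply: Cn_on_sum => // i _; apply: Cn_onM => //.
    exact: ((Cn_on_mx U_open m _).1 (Cn_on_derive j Hg) i).
  exact: IH (Cn_onS Hg) (Cn_on_derive i Hu).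
apply: Cn_on_ext H => // x Ux.
have [dgx dgE] := dg x Ux.
rewrite -[RHS]/('D_(delta_mx 0 j) (u \o g) x) [RHS]deriveE; last exact: dug.
have dux := du x Ux.
rewrite diff_comp // /= -(deriveE _ dgx) [in RHS](row_sum_delta ('D_(delta_mx 0 j) g x)) linear_sum.
by apply: eq_bigr => i _; rewrite linearZ /= -(deriveE _ dux).
Qed.

(** * Regularity of the inverse *)

Section inverse_regularity.
Variables (R : realType) (n : nat) (U V : set 'rV[R]_n) (f g : 'rV[R]_n -> 'rV[R]_n).
Hypotheses (U_open : open U) (V_open : open V).
Hypothesis gVU : forall y, V y -> U (g y).
Hypothesis fg : forall y, V y -> f (g y) = y.
Hypothesis f_C1 : Cn_on U 1 f.
Hypothesis f_unit : forall x, U x -> partials f x \in unitmx.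
Hypothesis g_lip : forall y, V y -> exists2 C : R, 0 < C &
  \forall z \near y, `|g z - g y| <= C * `|z - y|.
Implicit Types (x y z : 'rV[R]_n).

Lemma inverse_continuous y : V y -> {for y, continuous g}.
Proof.
move=> Vy; have [C C0 HC] := g_lip Vy.
apply/(@cvgrPdist_lt _ _ _ (nbhs y)) => e e0.
have eC : 0 < e / C by rewrite divr_gt0.
near=> z; rewrite distrC.
have zC : `|g z - g y| <= C * `|z - y| by near: z.
apply: le_lt_trans zC _; rewrite mulrC -ltr_pdivlMr // distrC; near: z.
Unshelve. all: by end_near. Qed.

(** With [k] the increment of [g], differentiability of [f] at [g y] reads [h *: v = k *m J + o(k)].
    The Lipschitz bound turns [o(k)] into [o(h)], and [invmx J] solves for [k]. *)
Lemma is_derive_inverse y (v : 'rV[R]_n) : V y -> is_derive y v g (v *m invmx (partials f (g y))).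
Proof.
move=> Vy; set J := partials f (g y); have Ju : J \in unitmx by exact/f_unit/gVU.
have [C C0 HC] := g_lip Vy.
have [B B0 HB] := normr_mulmx_bound (invmx J).
have [df dfE] := Cn_on_differentiable_rV U_open f_C1 (gVU Vy).
suff H : (fun h : R => h^-1 *: ((g \o shift y) (h *: v) - g y)) @ 0^' --> v *m invmx J.
  by split; [apply/cvg_ex; exists (v *m invmx J) | exact/cvg_lim].
apply/cvgrPdist_le => e e0.
(* The total loss: [B] from inverting [J], [C] from the increment of [g], and [|v| + 1], positive
   even for [v = 0], from the direction. *)
pose M := B * (C * (`|v| + 1)).
have v0 : 0 < `|v| + 1 by rewrite ltr_wpDl.
have M0 : 0 < M by rewrite !mulr_gt0.
have eM : 0 < e / M by rewrite divr_gt0.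
have /nbhs_ballP[r /= r0 rP] := diff_approx df eM.
have : \forall z \near y, V z /\ `|g z - g y| <= C * `|z - y|.
  by near=> z; split; near: z => //; exact: open_nbhs_nbhs.
move=> /nbhs_ballP[q /= q0 qP].
near=> h.
have h0 : h != 0 by near: h; exact: nbhs_dnbhs_neq.
have nh : 0 < `|h| by rewrite normr_gt0.
have hq : `|h| < q / (`|v| + 1) by near: h; apply: dnbhs0_lt; rewrite divr_gt0.
have hr : `|h| < r / (C * (`|v| + 1)).
  by near: h; apply: dnbhs0_lt; rewrite divr_gt0 // mulr_gt0.
have hv : `|h *: v| <= `|h| * (`|v| + 1) by rewrite normrZ ler_wpM2l // lerDl.
have [Vz gz] : V (h *: v + y) /\ `|g (h *: v + y) - g y| <= C * `|h *: v|.
  rewrite -{3}(addrK y (h *: v)); apply: qP; rewrite -ball_normE /= distrC addrK.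
  by apply: le_lt_trans hv _; rewrite -ltr_pdivlMr.
set k := g (h *: v + y) - g y in gz *.
have kh : `|k| <= C * (`|v| + 1) * `|h|.
  by apply: le_trans gz _; rewrite -mulrA ler_pM2l // mulrC.
have : `|f (k + g y) - f (g y) - 'd f (g y) k| <= e / M * `|k|.
  apply: rP; rewrite -ball_normE /= sub0r normrN.
  by apply: le_lt_trans kh _; rewrite mulrC -ltr_pdivlMr // mulr_gt0.
rewrite dfE /= subrK fg // fg // addrK => fk.
have -> : v *m invmx J - h^-1 *: ((g \o shift y) (h *: v) - g y)
    = h^-1 *: ((h *: v - k *m J) *m invmx J).
  rewrite mulmxBl -[k *m J *m _]mulmxA mulmxV // mulmx1 [RHS]scalerBr -scalemxAl scalerA.
  by rewrite mulVf // scale1r.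
rewrite normrZ normfV ler_pdivrMl //; apply: le_trans (HB _) _.
apply: (@le_trans _ _ (B * (e / M * (C * (`|v| + 1) * `|h|)))).
  rewrite ler_pM2l //; apply: le_trans fk _; rewrite ler_pM2l //.
by rewrite /M le_eqVlt; apply/orP; left; apply/eqP; field; rewrite !gt_eqF.
Unshelve. all: by end_near. Qed.

End inverse_regularity.

(** Bootstrapping from continuity: if [g] has order [k], so does the inverse matrix of partials of
    [f] taken at [g y]; its rows are the partials of [g], which therefore has order [k.+1]. *)
Lemma Cn_on_inverse (R : realType) (n m : nat) (U V : set 'rV[R]_n)
    (f g : 'rV[R]_n -> 'rV[R]_n) : open U -> open V ->
  (forall y, V y -> U (g y)) -> (forall y, V y -> f (g y) = y) ->
  (forall x, U x -> partials f x \in unitmx) ->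
  (forall y, V y -> exists2 C : R, 0 < C &
    \forall z \near y, `|g z - g y| <= C * `|z - y|) ->
  Cn_on U m.+1 f -> Cn_on V m.+1 g.
Proof.
move=> U_open V_open gVU fg f_unit g_lip.
have C1 k : Cn_on U k.+1 f -> Cn_on U 1 f.
  by elim: k => // k IH /Cn_onS.
have gc y : V y -> {for y, continuous g} by exact: (@inverse_continuous R n V g g_lip).
have step k : Cn_on U k.+1 f -> Cn_on V k g -> Cn_on V k.+1 g.
  move=> Hf Hg; have H1 := C1 _ Hf; split=> // j.
  have dg y : V y -> is_derive y (delta_mx 0 j) g
      (delta_mx 0 j *m invmx (partials f (g y))).
    by move=> Vy; exact: (@is_derive_inverse R n U V f g).
  split=> [y Vy|]; first by case: (dg y Vy).
  have Hpartials i l : Cn_on U k (fun x => partials f x i l).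
    have := (Cn_on_mx U_open _ _).1 (Cn_on_derive i Hf) l.
    by apply: Cn_on_ext => // x _; rewrite mxE.
  apply/(Cn_on_mx V_open) => i.
  have Hinv := Cn_on_invmx U_open f_unit Hpartials j i.
  have := Cn_on_comp V_open U_open gVU Hg Hinv.
  apply: Cn_on_ext => // y Vy; have [_ ->] := dg y Vy.
  by rewrite -rowE mxE.
elim: m => [|m IH] Hf; first by apply: step => //; split.
by apply: step => //; apply: IH; exact: Cn_onS.
Qed.

(** * The global inverse, its homogeneity, and the extension to the origin *)

Theorem theorem1p1 (R : realType) (n : nat) (n_ge3 : (3 <= n)%N)
    (k : option nat) (k_ge1 : k <> Some 0%N)
    (kappa : R) (kappa_gt0 : 0 < kappa)
    (f : 'rV[R]_n -> 'rV[R]_n)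
    (f_homog : pos_homogeneous kappa f)
    (f_Ck : Ck_on [set~ 0] k f)
    (jac_neq0 : forall x : 'rV[R]_n, x != 0 -> \det ('J f x) != 0) :
  [/\ set_bij [set~ 0] [set~ 0] f,
      exists g : 'rV[R]_n -> 'rV[R]_n,
        [/\ set_bij [set~ 0] [set~ 0] g,
            forall x : 'rV[R]_n, x != 0 -> g (f x) = x,
            forall y : 'rV[R]_n, y != 0 -> f (g y) = y,
            Ck_on [set~ 0] k g
          & pos_homogeneous kappa^-1 g]
    & homeomorphism (extend0 f)].
Proof.
pose U : set 'rV[R]_n := [set~ 0]; have U_open : open U by exact: open_nonzero.
have n0 : (0 < n)%N by exact: ltnW (ltnW n_ge3).
have f_C1 : Cn_on U 1 f.
  have C1 m : Cn_on U m.+1 f -> Cn_on U 1 f by elim: m => // m IH /Cn_onS.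
  by case: k k_ge1 f_Ck => [[|m]|] // _; exact: C1.
have f_cont (x : 'rV[R]_n) : x != 0 -> {for x, continuous f}.
  by move=> /eqP x0; exact: (Cn_on_cont f_C1 x0).
have f_unit (x : 'rV[R]_n) : U x -> partials f x \in unitmx.
  move=> Ux; rewrite unitmxE unitfE; move/eqP : (Ux) => /jac_neq0.
  have [_ dfE] := Cn_on_differentiable_rV U_open f_C1 Ux.
  suff -> : partials f x = 'J f x by [].
  apply/matrixP => i j.
  by rewrite /jacobian [RHS]mxE dfE /= -rowE [RHS]mxE.
have f_inv (x : 'rV[R]_n) : x != 0 ->
    \forall x' \near x & d \near 0^'+, quant_inv U f d x'.
  move=> /eqP x0; apply: near_quant_inv => //; last exact: f_unit.
    by move=> z j Uz; exact: (Cn_on_derivable f_C1 Uz).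
  move=> z j Uz; have := Cn_on_cont (Cn_on_derive j f_C1) Uz; exact.
have f0 := homogeneous_neq0 f_homog f_inv.
have f_inj := homogeneous_inj n_ge3 kappa_gt0 f_homog f_cont f_inv.
have f_surj := homogeneous_surj n_ge3 kappa_gt0 f_homog f_cont f_inv.
(* With the premise inside the existential, choice yields a total [g]. Its value at 0 is left open;
   [extend0] fixes it in the end. *)
have : forall y, exists x, y != 0 -> x != 0 /\ f x = y.
  move=> y; have [->|y0] := eqVneq y 0; first by exists 0.
  by have [x x0 fx] := f_surj y y0; exists x.
move=> /choice[g gP].
have g0 y : y != 0 -> g y != 0 by move=> /gP[].
have fg y : y != 0 -> f (g y) = y by move=> /gP[].
have gf x : x != 0 -> g (f x) = x.
  by move=> x0; apply: f_inj => //; rewrite ?fg ?g0 ?f0.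
have g_lip y : U y -> exists2 C : R, 0 < C &
    \forall z \near y, `|g z - g y| <= C * `|z - y|.
  move=> /eqP y0; have [d d0 [q1 q2]] := nonzero_quant_inv f_inv (g0 y y0).
  exists d^-1; first by rewrite invr_gt0.
  (* Openness of [f] at [g y] with radius [d] reaches every value within [d * d] of [y]; the lower
     Lipschitz bound of [f] is then the Lipschitz bound of [g]. *)
  apply/nbhs_ballP; exists (d * d); first by rewrite /= mulr_gt0.
  move=> z; rewrite -ball_normE /= distrC => zy.
  have [||x xd fx] := q2 d z; [by rewrite d0 lexx | by rewrite fg |].
  have [/eqP x0 qx _] := q1 x xd.
  by rewrite -fx gf // ler_pdivlMl // -{2}(fg y y0).
have gU y : U y -> U (g y) by move=> /eqP y0; apply/eqP; exact: g0.
have fgU y : U y -> f (g y) = y by move=> /eqP; exact: fg.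
have g_cont (y : 'rV[R]_n) : y != 0 -> {for y, continuous g}.
  by move=> /eqP y0; exact: (@inverse_continuous R n U g g_lip).
have g_homog : pos_homogeneous kappa^-1 g.
  move=> t y t0 y0; have s0 : 0 < t `^ kappa^-1 by rewrite powR_gt0.
  (* The right-hand side is rewritten as [g] of its image under [f], and by homogeneity of [f] that
     image is [t *: y]. *)
  rewrite -[RHS]gf ?scaler_eq0 ?negb_or ?gt_eqF ?g0 // f_homog ?g0 // fg //.
  by rewrite -powRrM mulVf ?gt_eqF // powRr1 // ltW.
split.
- split=> [x /eqP x0|x y|y /eqP y0]; first exact/eqP/f0.
    by rewrite !inE => /eqP x0 /eqP y0; exact: f_inj.
  by have [x /eqP x0 fx] := f_surj y y0; exists x.
- exists g; split=> //.
    split=> [y|y z|x /eqP x0]; first exact: gU.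
      by rewrite !inE => Uy Uz E; rewrite -(fgU y Uy) E fgU.
    by exists (f x); [exact/eqP/f0 | rewrite gf].
  have Hg m : Cn_on U m.+1 f -> Cn_on U m.+1 g by exact: Cn_on_inverse.
  case: k k_ge1 f_Ck => [[|m]|] // _ Hf; first exact: Hg.
  (* Regularity of the inverse starts at order 1, so order [m] is read off from order [m.+1]. *)
  by move=> m; exact/Cn_onS/Hg/Hf.
- split; first exact: (continuous_extend0 n0 kappa_gt0 f_homog f_cont).
  exists (extend0 g); split.
  + move=> x; rewrite /extend0; have [->|x0] := eqVneq x 0; first by rewrite eqxx.
    by rewrite (negbTE (f0 x x0)) gf.
  + move=> y; rewrite /extend0; have [->|y0] := eqVneq y 0; first by rewrite eqxx.
    by rewrite (negbTE (g0 y y0)) fg.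
  + by apply: (continuous_extend0 n0 _ g_homog g_cont); rewrite invr_gt0.
Qed.
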